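(* Let $d$ and $n$ be positive integers. Set $a_n=\left(\frac{\ln n}{n}\right)^{1/d}$, $b_n=n^{-1/d}$ and $L=\frac{(2d)^{d-1}\kappa_{d-1}}{3\kappa_d}$. Then $$\sup_{K\in\mathcal{K}_d}\mathbb{P}_K\left[\mathsf{d}_{\mathsf L}(\hat K_n,K)\ge 8d\,a_n+8d\,b_nx\right]\le 12^d\exp\left(-Lx^d\right)$$ for all $x\ge 0$ with $a_n+b_nx\le 1/(16d)$, where, under $\mathbb{P}_K$, $\hat K_n$ is the convex hull of $n$ i.i.d. points uniformly distributed in $K$.
   Context: $\kappa_p$ is the $p$-dimensional volume of the Euclidean unit ball in $\mathbb{R}^p$ ($\kappa_0=1$). $\mathcal{K}_d$ is the class of all convex bodies in $\mathbb{R}^d$, i.e. compact convex sets with nonempty interior. For two sets $K,K'\subset\mathbb{R}^d$, $$\mathsf{d}_{\mathsf L}(K,K')=\inf\{\varepsilon\ge 0:\exists a\in\mathbb{R}^d,\ a+(1+\varepsilon)^{-1}(K-a)\subseteq K'\subseteq a+(1+\varepsilon)(K-a)\}$$ (with $\inf\emptyset=+\infty$). *)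

(* Defs.v *)
From HB Require Import structures.
From mathcomp Require Import all_boot all_order all_algebra.
From mathcomp Require Import all_classical all_reals all_analysis.
Set Implicit Arguments.
Unset Strict Implicit.
Unset Printing Implicit Defensive.
Import Order.TTheory GRing.Theory Num.Theory.
Import numFieldNormedType.Exports.
Local Open Scope classical_set_scope.
Local Open Scope ring_scope.

(* The space R^d is 'rV[R]_d.  Its sigma-algebra is the one generated by the
   coordinates, i.e. the Borel sigma-algebra of the topology of 'rV[R]_d. *)
Section measurable_rV.
Context (R : realType) (d : nat).

Let coords : 'I_d -> 'rV[R]_d -> R := fun i v => v ord0 i.

Let rV_set0 : g_sigma_preimage coords set0.
Proof. exact: sigma_algebra0. Qed.

Let rV_setC A : g_sigma_preimage coords A -> g_sigma_preimage coords (~` A).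
Proof. exact: sigma_algebraC. Qed.

Let rV_bigcup (F : (set 'rV[R]_d)^nat) :
  (forall i, g_sigma_preimage coords (F i)) ->
  g_sigma_preimage coords (\bigcup_i F i).
Proof. exact: sigma_algebra_bigcup. Qed.

HB.instance Definition _ := @isMeasurable.Build default_measure_display
  'rV[R]_d (g_sigma_preimage coords) rV_set0 rV_setC rV_bigcup.

End measurable_rV.

Lemma measurable_rV_coord (R : realType) (d : nat) (i : 'I_d) :
  measurable_fun [set: 'rV[R]_d] (fun v => v ord0 i).
Proof.
move=> _ A mA; apply: sub_sigma_algebra.
case: d i => [[] []//|d i].
rewrite -bigcup_mkord_ord; exists i; first exact: ltn_ord.
by exists A => //; rewrite inord_val.
Qed.

Lemma measurable_fun_rVP (R : realType) (d : nat) (disp : measure_display)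
    (T : measurableType disp) (f : T -> 'rV[R]_d) :
  (forall i, measurable_fun [set: T] (fun t => f t ord0 i)) ->
  measurable_fun [set: T] f.
Proof.
move=> mf.
suff : g_sigma_preimage (fun (i : 'I_d) t => f t ord0 i) `<=` measurable.
  by rewrite (g_sigma_preimage_comp (fun (i : 'I_d) (v : 'rV[R]_d) => v ord0 i) f)
    => H _ A mA; apply: H; exists A.
apply: smallest_sub; first exact: sigma_algebra_measurable.
case: d f mf => [|d] f mf; first by rewrite big_ord0.
rewrite -bigcup_mkord_ord; apply: bigcup_sub => i _ A [B mB <-].
exact: mf.
Qed.

Section lebesgue_rV.
Context (R : realType).

Definition cons_rV (d : nat) (p : measurableTypeR R * 'rV[R]_d) : 'rV[R]_d.+1 :=
  row_mx (p.1)%:M p.2.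

Definition uncons_rV (d : nat) (v : 'rV[R]_d.+1) : measurableTypeR R * 'rV[R]_d :=
  (v ord0 ord0, \row_j v ord0 (lift ord0 j)).

Lemma cons_rVK (d : nat) : cancel (@cons_rV d) (@uncons_rV d).
Proof.
move=> [x v]; rewrite /uncons_rV /cons_rV /=; congr pair.
  have -> : ord0 = lshift d (@ord0 0) by exact: val_inj.
  by rewrite [LHS](row_mxEl (x%:M : 'M[R]_(1, 1)) v) mxE.
apply/rowP => j; rewrite mxE.
have -> : lift ord0 j = rshift 1 j by exact: val_inj.
exact: (row_mxEr (x%:M : 'M[R]_(1, 1)) v).
Qed.

Lemma measurable_cons_rV (d : nat) : measurable_fun setT (@cons_rV d).
Proof.
apply: measurable_fun_rVP => i; rewrite /cons_rV.
rewrite -(splitK (i : 'I_(1 + d))).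
case: (fintype.split (i : 'I_(1 + d))) => j /=.
  rewrite (_ : (fun _ => _) = fst); first exact: measurable_fst.
  by apply/funext => p; rewrite [LHS](row_mxEl (p.1%:M : 'M[R]_(1, 1))) mxE (ord1 j).
rewrite (_ : (fun _ => _) = (fun v : 'rV[R]_d => v ord0 j) \o snd); last first.
  by apply/funext => p; rewrite [LHS](row_mxEr (p.1%:M : 'M[R]_(1, 1))).
by apply: (measurableT_comp (measurable_rV_coord j)); exact: measurable_snd.
Qed.

Lemma measurable_uncons_rV (d : nat) : measurable_fun setT (@uncons_rV d).
Proof.
apply: measurable_fun_pair; first exact: measurable_rV_coord.
apply: measurable_fun_rVP => i.
under eq_fun do rewrite mxE.
exact: measurable_rV_coord.
Qed.

Section step.
Context (d : nat) (mu : {sigma_finite_measure set 'rV[R]_d -> \bar R}).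

Definition lebesgue_rV_step : set 'rV[R]_d.+1 -> \bar R :=
  pushforward (@lebesgue_measure R \x mu)%E (@cons_rV d).

Let step0 : lebesgue_rV_step set0 = 0%E.
Proof. by rewrite /lebesgue_rV_step /pushforward preimage_set0 measure0. Qed.

Let step_ge0 A : (0 <= lebesgue_rV_step A)%E.
Proof. by rewrite /lebesgue_rV_step /pushforward measure_ge0. Qed.

Let step_sigma_additive : semi_sigma_additive lebesgue_rV_step.
Proof.
move=> F mF tF mUF; rewrite /lebesgue_rV_step /pushforward preimage_bigcup.
have mcons A : measurable A -> measurable (@cons_rV d @^-1` A).
  by move=> mA; rewrite -[X in measurable X]setTI; exact: measurable_cons_rV.
apply: measure_semi_sigma_additive.
- by move=> n; exact: mcons.
- apply/trivIsetP => /= i j _ _ ij; rewrite -preimage_setI.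
  by move/trivIsetP : tF => /(_ _ _ _ _ ij) ->//; rewrite preimage_set0.
- by rewrite -preimage_bigcup; exact: mcons.
Qed.

HB.instance Definition _ := isMeasure.Build _ _ _
  lebesgue_rV_step step0 step_ge0 step_sigma_additive.

Let step_sigma_finite : sigma_finite setT lebesgue_rV_step.
Proof.
have /sigma_finiteP[F [TF ndF Foo]] := sigma_finiteT (@lebesgue_measure R).
have /sigma_finiteP[G [TG ndG Goo]] := sigma_finiteT mu.
exists (fun n => @uncons_rV d @^-1` (F n `*` G n)).
  rewrite -preimage_bigcup (_ : \bigcup_n _ = setT) ?preimage_setT//.
  apply/seteqP; split => // -[x v] _.
  have [i _ Fx] : (\bigcup_n F n) x by rewrite -TF.
  have [j _ Gv] : (\bigcup_n G n) v by rewrite -TG.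
  exists (maxn i j) => //; split => /=.
    by move: x Fx; exact/subsetPset/ndF/leq_maxl.
  by move: v Gv; exact/subsetPset/ndG/leq_maxr.
move=> n; have [mF Fn] := Foo n; have [mG Gn] := Goo n; split.
  rewrite -[X in measurable X]setTI; apply: measurable_uncons_rV => //.
  exact: measurableX.
rewrite /lebesgue_rV_step /pushforward.
rewrite (_ : _ @^-1` _ = F n `*` G n); last first.
  by apply/funext => p; rewrite /preimage /mkset cons_rVK.
by rewrite product_measure1E// lte_mul_pinfty// ge0_fin_numE.
Qed.

HB.instance Definition _ := Measure_isSigmaFinite.Build _ _ _
  lebesgue_rV_step step_sigma_finite.

End step.

(* d-dimensional Lebesgue measure: the d-fold product of lebesgue_measure *)
Fixpoint lebesgue_rV (d : nat) : {sigma_finite_measure set 'rV[R]_d -> \bar R} :=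
  match d with
  | 0 => \d_(0 : 'rV[R]_0)
  | d'.+1 => lebesgue_rV_step (lebesgue_rV d')
  end.

End lebesgue_rV.
Arguments lebesgue_rV {R} d.

Section euclidean.
Context (R : realType).

(* The library's norm `|v| on 'rV[R]_d is the sup norm, hence this definition. *)
Definition norm2 (d : nat) (v : 'rV[R]_d) : R :=
  Num.sqrt (\sum_(i < d) v ord0 i ^+ 2).

Definition kappa (p : nat) : R :=
  fine (lebesgue_rV p [set v : 'rV[R]_p | norm2 v <= 1]).

Definition convex_body (d : nat) (K : set 'rV[R]_d) : Prop :=
  [/\ compact K, convex_set K & K° !=set0].

Definition convex_hull (d : nat) (A : set 'rV[R]_d) : set 'rV[R]_d :=
  smallest (@convex_set R 'rV[R]_d) A.

Definition dilation (d : nat) (a : 'rV[R]_d) (r : R) (K : set 'rV[R]_d) :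
  set 'rV[R]_d := [set a + r *: (y - a) | y in K].

(* The infimum is taken in \bar R because the set may be empty. *)
Definition dist_L (d : nat) (K K' : set 'rV[R]_d) : \bar R :=
  ereal_inf [set e%:E | e in [set e : R | 0 <= e /\
    exists a : 'rV[R]_d, dilation a (1 + e)^-1 K `<=` K' /\
                         K' `<=` dilation a (1 + e) K]].

End euclidean.
Arguments kappa {R} p.

Section random_points.
Context (R : realType) (disp : measure_display) (T : measurableType disp).

Definition mutually_independent (disp' : measure_display)
    (T' : measurableType disp') (n : nat) (P : probability T R)
    (X : 'I_n -> {mfun T >-> T'}) : Prop :=
  forall (J : {set 'I_n}) (B : 'I_n -> set T'),
    (forall i, measurable (B i)) ->
    P (\bigcap_(i in [set` J]) (X i @^-1` B i)) =
    (\prod_(i in J) P (X i @^-1` B i))%E.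

Definition uniform_on (d : nat) (K : set 'rV[R]_d) (P : probability T R)
    (Y : {mfun T >-> 'rV[R]_d}) : Prop :=
  forall B : set 'rV[R]_d, measurable B ->
    distribution P Y B = (lebesgue_rV d (K `&` B) / lebesgue_rV d K)%E.

Definition iid_uniform (d n : nat) (K : set 'rV[R]_d) (P : probability T R)
    (X : 'I_n -> {mfun T >-> 'rV[R]_d}) : Prop :=
  mutually_independent P X /\ forall i, uniform_on K P (X i).

Definition random_hull (d n : nat) (X : 'I_n -> {mfun T >-> 'rV[R]_d}) (w : T) :
  set 'rV[R]_d := convex_hull [set X i w | i in [set: 'I_n]].

End random_points.

(* Main.v *)
Require Import Defs.
From HB Require Import structures.
From mathcomp Require Import all_boot all_order all_algebra.
From mathcomp Require Import all_classical all_reals all_analysis.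
From mathcomp Require Import measurable_realfun ring lra.
Set Implicit Arguments.
Unset Strict Implicit.
Unset Printing Implicit Defensive.
Import Order.TTheory GRing.Theory Num.Theory.
Import numFieldNormedType.Exports.
Local Open Scope classical_set_scope.
Local Open Scope ring_scope.

(** Fix a convex body [K] with centroid [a].  For a direction [u] the affine
    function [y |-> dot u (y - a)] has mean zero on [K]; say that [u] is
    normalised when its maximum on [K] is 1, and call the part of [K] where it
    is at least [1 - t] the cap of depth [t] in the direction [u].  Put
    [delta = a_n + b_n * x].  Separating points from the hull shows that, if
    every cap of depth [5 * d * delta] contains a sample point, then [K] shrunk
    about [a] by the factor [1 - 5 * d * delta] lies in the hull, and so
    [dist_L] is less than [8 * d * delta].  It remains to bound the probability
    that some cap is missed.

    The mean being zero, two bounds follow for every [u] in the polar body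
    [{u | dot u (y - a) <= 1 for all y in K}].  First, [dot u (y - a)] is at
    least [1 - 4 * d] on [K] ([polar_lower_bound]): a lower value would let a
    slightly contracted copy of [K] pull the mean below zero.  Second, the part
    of [K] where it is at least -1 has at least half of the volume; contracting
    that part towards the extreme point of a cap shows that a cap of depth
    [2 * tau] contains the fraction [tau ^ d / 2] of [K] ([cap_volume]).

    The first bound makes finitely many directions suffice ([net_sandwich]).
    Disjoint copies of the polar body, contracted by [delta / 12] towards
    normalised directions, all lie in the polar body, so there are at most
    [(12 / delta) ^ d] of them, and for a maximal family every normalised
    direction is close to one of the family ([packing_net]).  If the sample
    meets the caps of depth [4 * d * delta] of these directions, then it meets
    all caps of depth [5 * d * delta].  Hence ([hull_deviation]) the deviation
    has probability at most
    [(12 / delta) ^ d * (1 - (2 * d * delta) ^ d / 2) ^ n].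

    Finally [D = n * delta ^ d] is at least [ln n + x ^ d].  The first factor is
    [12 ^ d * n / D] and the second at most [exp (- (2 * d) ^ d / 2 * D)], which
    absorbs [n = exp (ln n)] and leaves [exp (- L * x ^ d)], because [L] is at
    most [(2 * d) ^ d / 3] ([kappa_ratio], [tail_bound]).  This uses [1 <= D],
    which fails only for [n = 1], where the claimed bound exceeds 1.

    A probability says nothing about a set that is not measurable, so the
    event itself has to be shown measurable ([measurable_dist_L_ge]). *)

(** * Lebesgue measure under homotheties *)

Lemma scaled_pushforward_measure (R : realType) (d1 d2 : measure_display)
    (T1 : measurableType d1) (T2 : measurableType d2)
    (m : {measure set T1 -> \bar R}) (f : T1 -> T2) (r : R) :
  measurable_fun setT f -> 0 <= r ->
  exists m' : {measure set T2 -> \bar R},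
    forall A, m' A = (r%:E * m (f @^-1` A))%E.
Proof.
move=> mf r0.
by exists (mscale (NngNum r0)
  (measure_function_pushforward__canonical__measure_function_Measure m mf)).
Qed.

Lemma lebesgue_measure_homothety (R : realType) (z r : R)
    (A : set (measurableTypeR R)) :
  0 < r -> measurable A ->
  lebesgue_measure ((fun x => r^-1 * (x - z)) @^-1` A) =
  (r%:E * lebesgue_measure A)%E.
Proof.
move=> r0 mA; pose f (x : measurableTypeR R) : measurableTypeR R := r^-1 * (x - z).
have mf : measurable_fun setT f.
  by apply: measurable_funM => //; apply: measurable_funB.
have r1 : 0 <= r^-1 by rewrite invr_ge0 ltW.
have [m' m'E] := scaled_pushforward_measure (@lebesgue_measure R) mf r1.
rewrite (@lebesgue_measure_unique R m' _ A mA) /=; last first.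
  move=> _ [[a b] _ <-] /=; rewrite m'E.
  have fE : f @^-1` `]a, b]%classic = `]z + r * a, z + r * b]%classic.
    apply/seteqP; split => x /=; rewrite !in_itv /= /f (mulrC r^-1);
      rewrite ltr_pdivlMr // ler_pdivrMr // => /andP[? ?]; apply/andP; split; lra.
  rewrite [X in (_ * X)%E](etrans (congr1 _ fE) (lebesgue_measure_itv `]z + r * a, z + r * b])).
  rewrite lebesgue_measure_itv /= !lte_fin ltrD2l ltr_pM2l //.
  case: ifPn => ab; last by rewrite mule0.
  by rewrite -!EFinB -EFinM; congr EFin; field; rewrite gt_eqF.
by rewrite m'E muleA -EFinM divff ?gt_eqF // mul1e.
Qed.

Lemma measurable_homothety (R : realType) (d : nat) (z : 'rV[R]_d) (r : R) :
  measurable_fun setT (fun x : 'rV[R]_d => r *: (x - z)).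
Proof.
apply: measurable_fun_rVP => i; under eq_fun do rewrite !mxE.
by apply: measurable_funM => //; apply: measurable_funB => //;
  exact: measurable_rV_coord.
Qed.

(** A product measure is determined by its values on rectangles, and on those
    the homothety acts on each factor separately. *)
Lemma lebesgue_rV_homothety (R : realType) (d : nat) (z : 'rV[R]_d) (r : R)
    (A : set 'rV[R]_d) :
  0 < r -> measurable A ->
  lebesgue_rV d ((fun x => r^-1 *: (x - z)) @^-1` A) =
  ((r ^+ d)%:E * lebesgue_rV d A)%E.
Proof.
move=> r0; elim: d z A => [|d IH] z A mA.
  rewrite expr0 mul1e /= /dirac !indicE; congr (_%:R%:E).
  by apply: (congr1 nat_of_bool); apply/idP/idP; rewrite !inE /=;
     rewrite (thinmx0 (_ *: _)).
have rn0 : r != 0 by rewrite gt_eqF.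
pose f (p : measurableTypeR R * 'rV[R]_d) : measurableTypeR R * 'rV[R]_d :=
  (r^-1 * (p.1 - z ord0 ord0), r^-1 *: (p.2 - \row_j z ord0 (lift ord0 j))).
have mf1 : measurable_fun setT (fun x : measurableTypeR R => r^-1 * (x - z ord0 ord0)).
  by apply: measurable_funM => //; apply: measurable_funB.
have mf2 := @measurable_homothety R d (\row_j z ord0 (lift ord0 j)) r^-1.
have mf : measurable_fun setT f.
  apply: measurable_fun_pair.
    exact: (measurableT_comp mf1 measurable_fst).
  exact: (measurableT_comp mf2 measurable_snd).
have r1 : 0 <= (r ^+ d.+1)^-1 by rewrite invr_ge0 exprn_ge0 // ltW.
have [m' m'E] := scaled_pushforward_measure
   (@lebesgue_measure R \x lebesgue_rV d)%E mf r1.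
rewrite /= /lebesgue_rV_step /pushforward.
have mcA : measurable (@cons_rV R d @^-1` A).
  by rewrite -[X in measurable X]setTI; exact: measurable_cons_rV.
rewrite [X in _ = (_ * X)%E](@product_measure_unique _ _ _ _ _ _ _ m') //; last first.
  move=> B C mB mC; rewrite m'E.
  have -> : f @^-1` (B `*` C) =
      ((fun x => r^-1 * (x - z ord0 ord0)) @^-1` B) `*`
      ((fun v : 'rV[R]_d => r^-1 *: (v - \row_j z ord0 (lift ord0 j))) @^-1` C).
    by apply/seteqP; split => -[x v].
  rewrite [X in (_ * X)%E]product_measure1E; last 2 first.
  - by rewrite -[X in measurable X]setTI; exact: mf1.
  - by rewrite -[X in measurable X]setTI; exact: mf2.
  rewrite [X in (_ * (X * _))%E](lebesgue_measure_homothety _ r0 mB).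
  rewrite [X in (_ * (_ * X))%E](IH _ _ mC) muleACA -EFinM -exprS.
  by rewrite [LHS]muleA -EFinM mulVf ?mul1e // expf_neq0.
rewrite m'E muleA -EFinM divff ?expf_neq0 // mul1e.
congr ((@lebesgue_measure R \x lebesgue_rV d)%E _).
apply/funext => p; rewrite /preimage /mkset; congr A; rewrite /f /cons_rV.
apply/rowP => i; rewrite !mxE; case: splitP => j ij; rewrite !mxE.
  rewrite !ord1 !mulr1n /=; congr (_ * (_ - z _ _)).
  by apply: val_inj; rewrite /= ij (ord1 j).
by congr (_ * (_ - z _ _)); apply: val_inj; rewrite /= ij.
Qed.

Lemma lebesgue_rV_cons (R : realType) (d : nat) (B : set (measurableTypeR R))
    (C : set 'rV[R]_d) (A : set 'rV[R]_d.+1) :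
  measurable B -> measurable C -> @cons_rV R d @^-1` A = B `*` C ->
  lebesgue_rV d.+1 A = (lebesgue_measure B * lebesgue_rV d C)%E.
Proof.
move=> mB mC AE; rewrite /= /lebesgue_rV_step /pushforward AE.
exact: product_measure1E.
Qed.

Lemma cons_rV0 (R : realType) (d : nat) (x : R) (v : 'rV[R]_d) :
  cons_rV (x, v) ord0 ord0 = x.
Proof. by have /(congr1 fst) := cons_rVK (x, v). Qed.

Lemma cons_rVS (R : realType) (d : nat) (x : R) (v : 'rV[R]_d) i :
  cons_rV (x, v) ord0 (lift ord0 i) = v ord0 i.
Proof. by have /(congr1 snd)/rowP/(_ i) := cons_rVK (x, v); rewrite mxE. Qed.

Definition cube (R : realType) (d : nat) (z : 'rV[R]_d) (r : R) : set 'rV[R]_d :=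
  [set v | forall i, `|v ord0 i - z ord0 i| <= r].

Lemma measurable_cube (R : realType) (d : nat) (z : 'rV[R]_d) (r : R) :
  measurable (cube z r).
Proof.
have -> : cube z r = \bigcap_(i in [set: 'I_d])
    ((fun v : 'rV[R]_d => v ord0 i - z ord0 i) @^-1` `[- r, r]%classic).
  apply/seteqP; split => v /= h i; first by move=> _ /=; rewrite in_itv /= -ler_norml.
  by have := h i I; rewrite /= in_itv /= ler_norml.
apply: fin_bigcap_measurable => // i _; rewrite -[X in measurable X]setTI.
apply: measurable_funB => //; exact: measurable_rV_coord.
Qed.

Lemma lebesgue_rV_unit_cube (R : realType) (d : nat) :
  lebesgue_rV d (cube (0 : 'rV[R]_d) 1) = (2 ^+ d)%:E.
Proof.
elim: d => [|d IH]; first by rewrite /= diracE mem_set //= => -[].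
rewrite (lebesgue_rV_cons (B := `[-1, 1]%classic) (C := cube 0 1)) //=; first last.
- apply/seteqP; split => -[x v] /= h.
    split; first by have := h ord0; rewrite cons_rV0 mxE subr0 in_itv /= ler_norml.
    by move=> i; have := h (lift ord0 i); rewrite cons_rVS !mxE.
  case: h => /= h1 h2 i; case: (unliftP ord0 i) => [j|] ->.
    by rewrite cons_rVS mxE; have := h2 j; rewrite mxE.
  by rewrite cons_rV0 mxE subr0; move: h1; rewrite in_itv /= ler_norml.
- exact: measurable_cube.
rewrite IH lebesgue_measure_itv /= lte_fin ifT; last by lra.
by rewrite -EFinB -EFinM exprS; congr (_ * _)%:E; lra.
Qed.

Lemma lebesgue_rV_cube (R : realType) (d : nat) (z : 'rV[R]_d) (r : R) :
  0 < r -> lebesgue_rV d (cube z r) = ((2 * r) ^+ d)%:E.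
Proof.
move=> r0; have -> : cube z r = (fun x => r^-1 *: (x - z)) @^-1` (cube 0 1).
  have r1 : 0 <= r^-1 by rewrite invr_ge0 ltW.
  apply/seteqP; split => v /= h i; have := h i; rewrite !mxE subr0 normrM;
  by rewrite (ger0_norm r1) (mulrC r^-1) ler_pdivrMr // mul1r.
rewrite lebesgue_rV_homothety //; last exact: measurable_cube.
by rewrite lebesgue_rV_unit_cube -EFinM exprMn mulrC.
Qed.

(** * Borel sets of matrices *)

(** Rational matrices are dense, so an open set is a countable union of boxes. *)
Lemma measurable_preimage_open (R : realType) (disp : measure_display)
    (T : measurableType disp) (m n : nat) (f : T -> 'M[R]_(m, n))
    (U : set 'M[R]_(m, n)) :
  (forall i j, measurable_fun setT (fun t => f t i j)) -> open U ->
  measurable (f @^-1` U).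
Proof.
move=> mf oU.
pose e (k : nat) : R := k.+1%:R^-1.
have e0 k : 0 < e k by rewrite invr_gt0 ltr0Sn.
pose F (p : 'M[rat]_(m, n) * nat) : set T :=
  if `[< ball (map_mx ratr p.1 : 'M[R]_(m, n)) (e p.2) `<=` U >]
  then \bigcap_(i in [set: 'I_m]) \bigcap_(j in [set: 'I_n])
         ((fun t => f t i j - ratr (p.1 i j)) @^-1` `]- e p.2, e p.2[%classic)
  else set0.
have -> : f @^-1` U = \bigcup_p F p.
  apply/seteqP; split => [t /= Ut|t [p _]]; last first.
    rewrite /F; case: asboolP => // sU h; apply: sU; split => [|i j]; first exact: e0.
    have := h i I j I; rewrite /= in_itv /= -ltr_norml distrC mxE.
    by move=> ?; rewrite /ball /=.
  have /nbhs_ballP[r /= r0 rU] : nbhs (f t) U by exact: open_nbhs_nbhs.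
  have [k kr] : exists k, e k < r / 2.
    have [k _ /(_ k (leqnn k))] := near_infty_natSinv_lt (PosNum (divr_gt0 r0 (ltr0Sn R 1))).
    by exists k.
  have /choice[q qE] : forall ij : 'I_m * 'I_n, exists q : rat,
      `|f t ij.1 ij.2 - ratr q| < e k.
    move=> ij; have ek0 := e0 k.
    have lt2 : f t ij.1 ij.2 - e k < f t ij.1 ij.2 + e k by lra.
    have [q] := rat_in_itvoo lt2; rewrite in_itv /= => /andP[h1 h2].
    by exists q; rewrite ltr_norml; apply/andP; split; lra.
  exists (\matrix_(i, j) q (i, j), k) => //; rewrite /F; case: asboolP => [_|].
    by move=> i _ j _; rewrite /= in_itv /= -ltr_norml mxE; exact: (qE (i, j)).
  case; move=> y [_ yb]; apply: rU; split => // i j.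
  have := yb i j; have := qE (i, j); rewrite /ball /= !mxE => h1 h2.
  rewrite -(subrK (ratr (q (i, j))) (f t i j)) -addrA.
  by apply: (le_lt_trans (ler_normD _ _)); lra.
apply: countable_bigcupT_measurable => [|p]; first exact: countableP.
rewrite /F; case: ifP => // _; apply: fin_bigcap_measurable => // i _.
apply: fin_bigcap_measurable => // j _; rewrite -[X in measurable X]setTI.
by apply: measurable_funB.
Qed.

Lemma measurable_preimage_closed (R : realType) (disp : measure_display)
    (T : measurableType disp) (m n : nat) (f : T -> 'M[R]_(m, n))
    (A : set 'M[R]_(m, n)) :
  (forall i j, measurable_fun setT (fun t => f t i j)) -> closed A ->
  measurable (f @^-1` A).
Proof.
move=> mf cA; rewrite -[A]setCK preimage_setC; apply: measurableC.
exact: (measurable_preimage_open mf (closed_openC cA)).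
Qed.

Lemma closed_measurable_rV (R : realType) (d : nat) (A : set 'rV[R]_d) :
  closed A -> measurable A.
Proof.
move=> cA; apply: (@measurable_preimage_closed R _ _ 1 d (@id 'rV[R]_d) A) => // i j.
by rewrite (ord1 i); exact: measurable_rV_coord.
Qed.

Lemma coord_le_norm (R : realType) (m n : nat) (v : 'M[R]_(m, n)) i j :
  `|v i j| <= `|v|.
Proof.
rewrite [leRHS]/Num.norm /= mx_normrE.
by apply/bigmax_geP; right => /=; exists (i, j).
Qed.

Lemma compact_sub_cube (R : realType) (d : nat) (K : set 'rV[R]_d) :
  compact K -> exists2 M, 0 < M & K `<=` cube 0 M.
Proof.
move=> /compact_bounded[M [_ KM]]; exists (Num.max M 0 + 1).
  by rewrite ltr_wpDl // le_max lexx orbT.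
move=> v Kv i; rewrite mxE subr0; apply: le_trans (coord_le_norm _ _ _) _.
by apply: KM => //; rewrite ltr_pwDr // le_max lexx.
Qed.

Lemma interior_sub_cube (R : realType) (d : nat) (K : set 'rV[R]_d) z :
  K° z -> exists2 r, 0 < r & cube z r `<=` K.
Proof.
move=> /nbhs_ballP[e /= e0 eK]; exists (e / 2); first by rewrite divr_gt0.
move=> v vz; apply: eK; split => // i j; rewrite (ord1 i) /ball /= distrC.
by apply: le_lt_trans (vz j) _; rewrite ltr_pdivrMr // mulr2n mulrDr mulr1 ltrDr.
Qed.

(** * The scalar product and separation *)

Section dot_product.
Context (R : realType) (d : nat).
Implicit Types u v w : 'rV[R]_d.

Definition dot u v : R := \sum_i u ord0 i * v ord0 i.

Lemma dotC u v : dot u v = dot v u.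
Proof. by apply: eq_bigr => i _; rewrite mulrC. Qed.

Lemma dotDr u v w : dot u (v + w) = dot u v + dot u w.
Proof. by rewrite -big_split; apply: eq_bigr => i _; rewrite mxE mulrDr. Qed.

Lemma dotZr u v (r : R) : dot u (r *: v) = r * dot u v.
Proof. by rewrite mulr_sumr; apply: eq_bigr => i _; rewrite mxE mulrCA. Qed.

Lemma dotNr u v : dot u (- v) = - dot u v.
Proof. by rewrite -scaleN1r dotZr mulN1r. Qed.

Lemma dotDl u v w : dot (u + v) w = dot u w + dot v w.
Proof. by rewrite dotC dotDr !(dotC w). Qed.

Lemma dotZl u v (r : R) : dot (r *: u) v = r * dot u v.
Proof. by rewrite dotC dotZr dotC. Qed.

Lemma dotNl u v : dot (- u) v = - dot u v.
Proof. by rewrite dotC dotNr dotC. Qed.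

Definition dotE := (dotDr, dotDl, dotNr, dotNl, dotZr, dotZl).

Lemma dot_ge0 u : 0 <= dot u u.
Proof. by apply: sumr_ge0 => i _; rewrite -expr2 sqr_ge0. Qed.

Lemma dot_gt0 u : u != 0 -> 0 < dot u u.
Proof.
move=> u0; rewrite lt_neqAle dot_ge0 andbT; apply: contra u0 => /eqP/esym/eqP.
rewrite psumr_eq0 => [/allP h|i _]; last by rewrite -expr2 sqr_ge0.
apply/eqP/rowP => i; have := h i; rewrite mem_index_enum => /(_ isT).
by rewrite mxE mulf_eq0 orbb => /eqP.
Qed.

Lemma dot_delta u i : dot u (delta_mx ord0 i) = u ord0 i.
Proof.
rewrite /dot (bigD1 i) //= big1 => [|j ji]; rewrite mxE !eqxx /=.
  by rewrite mulr1 addr0.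
by rewrite (negbTE ji) mulr0.
Qed.

Lemma continuous_dot (T : topologicalType) (f g : T -> 'rV[R]_d) :
  continuous f -> continuous g -> continuous (fun x => dot (f x) (g x)).
Proof.
move=> cf cg; apply: continuous_big => [|i _ x]; [exact: add_continuous|apply: cvgM].
  exact: (continuous_comp (cf x) (@coord_continuous _ _ _ _ _ _)).
exact: (continuous_comp (cg x) (@coord_continuous _ _ _ _ _ _)).
Qed.

Lemma convex_setP (A : set 'rV[R]_d) :
  convex_set A <-> forall x y (t : R), A x -> A y -> 0 <= t <= 1 ->
    A (t *: x + (1 - t) *: y).
Proof.
split => [cA x y t Ax Ay t01|cA x y t].
  pose l : {i01 R} := Itv01 (andP t01).1 (andP t01).2.
  by have := cA x y l; rewrite !inE; exact.
rewrite !inE => Ax Ay; apply: cA => //; apply/andP; split; [exact: ge0|exact: le1].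
Qed.

(** The separating direction points from the nearest point of [A] to [q]. *)
Lemma strict_separation (A : set 'rV[R]_d) (q : 'rV[R]_d) :
  compact A -> convex_set A -> ~ A q ->
  exists u, forall y, A y -> dot u y < dot u q.
Proof.
move=> coA /convex_setP cA Aq.
have [A0|A0] := pselect (A !=set0); last first.
  by exists 0 => y Ay; case: A0; exists y.
pose g (y : 'rV[R]_d) := dot (y - q) (y - q).
have cg : continuous g.
  have cs : continuous (fun y : 'rV[R]_d => y - q).
    move=> y; apply: (@continuousB _ _ _ id (cst q)); [exact: cvg_id|exact: cst_continuous].
  exact: continuous_dot.
have [p /set_mem Ap pmin] := compact_EVT_min A0 coA (continuous_subspaceT cg).
have pq : 0 < dot (q - p) (q - p).
  by apply: dot_gt0; apply/negP => /eqP/subr0_eq qp; apply: Aq; rewrite qp.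
exists (q - p) => y Ay.
suff h : dot (q - p) (y - p) <= 0.
  by rewrite -subr_gt0; move: pq h; rewrite !dotE; lra.
rewrite leNgt; apply/negP => h.
set N := dot (y - p) (y - p).
have N0 : 0 <= N by exact: dot_ge0.
(* The quadratic t |-> |p + t (y - p) - q|^2 decreases at 0; this t is a step
   small enough to stay in [0, 1] and within the decrease. *)
pose t := dot (q - p) (y - p) / (dot (q - p) (y - p) + N).
have t0 : 0 < t by rewrite divr_gt0 // ltr_wpDr.
have t1 : t <= 1 by rewrite ler_pdivrMr ?mul1r ?lerDl // ltr_wpDr.
have tN : t * N < 2 * dot (q - p) (y - p).
  apply: (@le_lt_trans _ _ (dot (q - p) (y - p))); last by lra.
  rewrite /t mulrAC ler_pdivrMr ?ltr_wpDr // ler_pM2l //; lra.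
have := pmin (t *: y + (1 - t) *: p).
rewrite inE => /(_ (cA _ _ _ Ay Ap _)); rewrite (ltW t0) t1 => /(_ isT).
have -> : g (t *: y + (1 - t) *: p) =
    g p - 2 * t * dot (q - p) (y - p) + t ^+ 2 * N.
  by rewrite /g /N !dotE (dotC p y) (dotC q y) (dotC q p); ring.
have : t * (t * N) < t * (2 * dot (q - p) (y - p)) by rewrite ltr_pM2l.
lra.
Qed.

End dot_product.

(** * Convex hulls of finitely many points *)

Section convex_hull_of_points.
Context (R : realType) (d : nat).

(** Normalising the weights only at the end lets the induction start from the
    empty sum, whose total weight is zero. *)
Lemma convex_combination (A : set 'rV[R]_d) (I : Type) (s : seq I)
    (w : I -> R) (x : I -> 'rV[R]_d) :
  convex_set A -> A !=set0 -> (forall i, 0 <= w i) -> (forall i, A (x i)) ->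
  exists2 c, A c & \sum_(i <- s) w i *: x i = (\sum_(i <- s) w i) *: c.
Proof.
move=> /convex_setP cA [c0 Ac0] w0 Ax; elim: s => [|i s [c Ac IH]].
  by exists c0 => //; rewrite !big_nil scale0r.
have s0 : 0 <= \sum_(j <- s) w j by exact: sumr_ge0.
have wi0 := w0 i; rewrite !big_cons IH.
have [wis|wis] := eqVneq (w i + \sum_(j <- s) w j) 0.
  exists c => //; have -> : \sum_(j <- s) w j = 0 by lra.
  by have -> : w i = 0 by [lra]; rewrite addr0 !scale0r addr0.
have wis0 : 0 < w i + \sum_(j <- s) w j by rewrite lt_neqAle eq_sym wis addr_ge0.
exists ((w i / (w i + \sum_(j <- s) w j)) *: x i +
        (1 - w i / (w i + \sum_(j <- s) w j)) *: c).
  apply: cA => //; apply/andP; split; first by rewrite divr_ge0 // ltW.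
  by rewrite ler_pdivrMr // mul1r lerDl.
rewrite scalerDr !scalerA; congr (_ *: _ + _ *: _); field; exact: wis.
Qed.

Definition simplex (n : nat) : set 'rV[R]_n :=
  [set w | (forall i, 0 <= w ord0 i) /\ \sum_i w ord0 i = 1].

Lemma compact_simplex (n : nat) : compact (@simplex n).
Proof.
have -> : @simplex n = [set w : 'rV[R]_n | forall i, `[0, 1]%classic (w ord0 i)] `&`
    ((fun w : 'rV[R]_n => \sum_i w ord0 i) @^-1` [set 1]).
  apply/seteqP; split => [w [w0 w1]|w [/= w01 w1]]; split => //= i.
    rewrite in_itv /= w0 /= -w1 (bigD1 i) //= lerDl; exact: sumr_ge0.
  by have := w01 i; rewrite in_itv /= => /andP[].
apply: compact_closedI.
  apply: (@rV_compact R n (fun=> `[0, 1]%classic)) => _; exact: segment_compact.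
apply: preimage_closed; last exact: closed_eq.
move=> w _; apply: continuous_big => [|i _ v]; [exact: add_continuous|].
exact: coord_continuous.
Qed.

(** Membership in the hull as a closed condition on the point and the vertices
    together; this form is what both the measurability of the event and the
    search for a missed cap need. *)
Lemma convex_hull_pointsP (n : nat) (x : 'I_n -> 'rV[R]_d) (q : 'rV[R]_d) :
  (0 < n)%N ->
  convex_hull [set x i | i in [set: 'I_n]] q <->
  forall u, exists i, dot u q <= dot u (x i).
Proof.
move=> n0; pose i0 := Ordinal n0; split => [hq u|hq].
  suff : convex_hull [set x i | i in [set: 'I_n]] `<=`
      [set y | exists i, dot u y <= dot u (x i)] by apply.
  apply: smallest_sub; last by move=> _ [i _ <-]; exists i.
  apply/convex_setP => y z t [i yi] [j zj] /andP[t0 t1].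
  have [ij|ji] := leP (dot u (x i)) (dot u (x j)).
    exists j; rewrite !dotE; have := ler_wpM2l t0 (le_trans yi ij).
    have := ler_wpM2l (_ : 0 <= 1 - t) zj; rewrite subr_ge0 => /(_ t1); lra.
  exists i; rewrite !dotE; have := ler_wpM2l t0 yi.
  have := ler_wpM2l (_ : 0 <= 1 - t) (le_trans zj (ltW ji)).
  rewrite subr_ge0 => /(_ t1); lra.
(* The convex combinations of the points are a compact convex part of the hull
   that contains the points. *)
pose g (w : 'rV[R]_n) : 'rV[R]_d := \sum_i w ord0 i *: x i.
have coW : compact (g @` @simplex n).
  apply: continuous_compact; last exact: compact_simplex.
  apply: continuous_subspaceT; apply: continuous_big => [|i _ w].
    exact: add_continuous.
  exact: (cvgZr_tmp (@coord_continuous R 1 n ord0 i w)).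
have cW : convex_set (g @` @simplex n).
  apply/convex_setP => _ _ t [w [w0 w1] <-] [v [v0 v1] <-] /andP[t0 t1].
  exists (t *: w + (1 - t) *: v).
    split => [i|]; first by rewrite !mxE addr_ge0 // mulr_ge0 ?subr_ge0.
    under eq_bigr do rewrite !mxE; rewrite big_split /= -!mulr_sumr w1 v1; lra.
  rewrite /g !scaler_sumr -big_split /=; apply: eq_bigr => i _.
  by rewrite !mxE !scalerA -scalerDl.
have Wx i : (g @` @simplex n) (x i).
  exists (delta_mx ord0 i).
    split => [j|]; first by rewrite mxE ler0n.
    rewrite (bigD1 i) //= big1 => [|j ji]; rewrite mxE !eqxx /= ?addr0 //.
    by rewrite (negbTE ji).
  rewrite /g (bigD1 i) //= big1 => [|j ji]; rewrite mxE !eqxx /=.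
    by rewrite scale1r addr0.
  by rewrite (negbTE ji) scale0r.
have [[w [w0 w1] <-]|nWq] := pselect ((g @` @simplex n) q).
  move=> A [cA xA].
  have A0 : A !=set0 by exists (x i0); apply: xA; exists i0.
  have Ax i : A (x i) by apply: xA; exists i.
  have [c Ac] := convex_combination (index_enum 'I_n) cA A0 w0 Ax.
  by rewrite /g => ->; rewrite w1 scale1r.
have [u hu] := strict_separation coW cW nWq.
by have [i] := hq u; have := hu _ (Wx i); rewrite ltNge => /negP.
Qed.

End convex_hull_of_points.

(** * Measurability of the deviation event *)

Lemma continuous_mx (R : realType) (T : topologicalType) (m n : nat)
    (f : T -> 'M[R]_(m, n)) :
  (forall i j, continuous (fun t => f t i j)) -> continuous f.
Proof.
move=> cf t A [P nP sPA].
have : \forall t' \near t, forall ij : 'I_m * 'I_n, P ij.1 ij.2 (f t' ij.1 ij.2).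
  by apply: filter_forall => ij; exact: (cf ij.1 ij.2 t _ (nP ij.1 ij.2)).
by apply: filterS => t' h; apply: sPA => i j; exact: (h (i, j)).
Qed.

(** By compactness of [C], if [G] avoids the slice of [C] over [x], then it avoids
    the slices over all points near [x]. *)
Lemma closed_projection (X Y : topologicalType) (G : set (X * Y)) (C : set Y) :
  closed G -> compact C -> closed [set x | exists2 y, C y & G (x, y)].
Proof.
move=> cG /compact_near_coveringP coC; rewrite -openC openE => x /= nx.
suff : \near x, C `<=` (fun x' y => ~ G (x', y)) x.
  by apply: filterS => x' h [y Cy Gy]; exact: (h y Cy).
apply: coC => y Cy.
have : nbhs (x, y) (~` G).
  by apply: open_nbhs_nbhs; split; [exact: closed_openC|move=> Gxy; apply: nx; exists y].
case=> -[U V] [/= Ux Vy] UV; exists (V, U) => //= -[y' x'] [/= Vy' Ux'].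
exact: (UV (x', y')).
Qed.

(** For [rho = (1 + e)^-1] this is the two-sided inclusion in the definition of
    [dist_L] ([sandwich_centerP]), written with non-strict inequalities that are
    polynomial in [x], [rho] and [a], so that it defines a closed set. *)
Definition sandwich_center (R : realType) (n d : nat) (K : set 'rV[R]_d)
    (x : 'I_n -> 'rV[R]_d) (rho : R) (a : 'rV[R]_d) : Prop :=
  (forall i, K (a + rho *: (x i - a))) /\
  (forall y u, K y -> exists i, dot u (a + rho *: (y - a)) <= dot u (x i)).

Lemma sandwich_centerP (R : realType) (n d : nat) (K : set 'rV[R]_d)
    (x : 'I_n -> 'rV[R]_d) (e : R) (a : 'rV[R]_d) :
  (0 < n)%N -> convex_set K -> 0 <= e ->
  sandwich_center K x (1 + e)^-1 a <->
  dilation a (1 + e)^-1 (convex_hull [set x i | i in [set: 'I_n]]) `<=` K /\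
  K `<=` dilation a (1 + e) (convex_hull [set x i | i in [set: 'I_n]]).
Proof.
move=> n0 cK e0; have e1 : 1 + e != 0 by rewrite gt_eqF // ltr_pwDl.
have hx i : convex_hull [set x i | i in [set: 'I_n]] (x i).
  by move=> A [_]; apply; exists i.
split => [[xK Kx]|[hK Kh]]; split.
- move=> _ [y hy <-]; pose A := [set y | K (a + (1 + e)^-1 *: (y - a))].
  suff : convex_hull [set x i | i in [set: 'I_n]] `<=` A by apply.
  apply: smallest_sub; last by move=> _ [i _ <-]; exact: xK.
  apply/convex_setP => p q t Ap Aq t01; rewrite /A /=.
  have /convex_setP/(_ _ _ t Ap Aq t01) := cK; congr K.
  by apply/rowP => j; rewrite !mxE; ring.
- move=> y Ky; exists (a + (1 + e)^-1 *: (y - a)).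
    by apply/convex_hull_pointsP => // u; exact: Kx.
  by rewrite addrAC subrr add0r scalerA mulfV // scale1r addrC subrK.
- by move=> i; apply: hK; exists (x i).
- move=> y u /Kh[z hz <-]; have /convex_hull_pointsP := hz => /(_ n0 u)[i zi].
  by exists i; rewrite (addrAC a) subrr add0r scalerA mulVf // scale1r addrC subrK.
Qed.

Lemma closed_sandwich_center (R : realType) (n d : nat) (K : set 'rV[R]_d) :
  closed K ->
  closed [set p : 'M[R]_(n, d) * (R * 'rV[R]_d) |
    sandwich_center K (fun i => row i p.1) p.2.1 p.2.2].
Proof.
move=> cK.
pose h (v : 'M[R]_(n, d) * (R * 'rV[R]_d) -> 'rV[R]_d) p :=
  p.2.2 + p.2.1 *: (v p - p.2.2).
have ca : continuous (fun p : 'M[R]_(n, d) * (R * 'rV[R]_d) => p.2.2).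
  move=> p; apply: (@continuous_comp _ _ _ snd snd); exact: cvg_snd.
have cr : continuous (fun p : 'M[R]_(n, d) * (R * 'rV[R]_d) => p.2.1).
  move=> p; apply: (@continuous_comp _ _ _ snd fst); [exact: cvg_snd|exact: cvg_fst].
have cx i : continuous (fun p : 'M[R]_(n, d) * (R * 'rV[R]_d) => row i p.1).
  apply: continuous_mx => k j.
  rewrite (_ : (fun=> _) = (fun M : 'M[R]_(n, d) => M i j) \o fst); last first.
    by apply/funext => p; rewrite /= mxE.
  move=> p; apply: continuous_comp; first exact: cvg_fst.
  exact: coord_continuous.
have ch v : continuous v -> continuous (h v).
  move=> cv p; apply: cvgD; first exact: ca.
  by apply: cvgZ; [exact: cr|apply: cvgB; [exact: cv|exact: ca]].
have -> : [set p : 'M[R]_(n, d) * (R * 'rV[R]_d) |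
    sandwich_center K (fun i => row i p.1) p.2.1 p.2.2] =
  (\bigcap_(i in [set: 'I_n]) (h (fun p => row i p.1) @^-1` K)) `&`
  (\bigcap_(yu in [set yu | K yu.1]) \bigcup_(i in [set: 'I_n])
     [set p | dot yu.2 (h (fun=> yu.1) p) <= dot yu.2 (row i p.1)]).
  apply/seteqP; split => [p [h1 h2]|p [h1 h2]]; split.
  - by move=> i _; exact: h1.
  - by move=> [y u] /= Ky; have [i] := h2 y u Ky; exists i.
  - by move=> i; exact: h1.
  - by move=> y u Ky; have [i _ ?] := h2 (y, u) Ky; exists i.
apply: closedI; apply: closed_bigI.
  by move=> i _; apply: preimage_closed => // p _; apply: ch; exact: cx.
move=> [y u] _; apply: closed_bigcup => [|i _ /=]; first exact: finite_finset.
rewrite (_ : [set p | _] = (fun p => dot u (row i p.1) - dot u (h (fun=> y) p)) @^-1`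
  [set r | 0 <= r]); last by apply/seteqP; split => p /=; rewrite subr_ge0.
apply: preimage_closed; last exact: closed_ge.
have cc (v : 'rV[R]_d) : continuous (fun _ : 'M[R]_(n, d) * (R * 'rV[R]_d) => v).
  by move=> p; exact: cvg_cst.
have cd1 := continuous_dot (cc u) (cx i).
have cd2 := continuous_dot (cc u) (ch _ (cc y)).
by move=> p _; apply: (@continuousB _ _ _ _ _ p (cd1 p) (cd2 p)).
Qed.

(** [dist_L] is defined by an infimum over a real and a centre, so the event is
    the complement of a projection.  Restricting the parameters to the compact
    pieces [(1 + c)^-1 + 1/(k+1) <= rho <= 1], [|a| <= k] makes each piece of the
    projection closed. *)
Lemma measurable_dist_L_ge (R : realType) (disp : measure_display)
    (T : measurableType disp) (d n : nat) (K : set 'rV[R]_d)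
    (X : 'I_n -> {mfun T >-> 'rV[R]_d}) (c : R) :
  (0 < n)%N -> compact K -> convex_set K ->
  measurable [set w | (c%:E <= dist_L (random_hull X w) K)%E].
Proof.
move=> n0 coK cvK.
have [c0|c0] := leP c 0.
  rewrite (_ : [set w | _] = setT); first exact: measurableT.
  apply/seteqP; split => // w _ /=; apply/ereal_infP => _ [e [e0 _] <-].
  by rewrite lee_fin (le_trans c0).
have cK : closed K by apply: compact_closed => //; exact: norm_hausdorff.
pose M w : 'M[R]_(n, d) := \matrix_(i, j) X i w ord0 j.
have MX w : (fun i => row i (M w)) = (fun i => X i w).
  by apply/funext => i; apply/rowP => j; rewrite !mxE.
pose C k : set (R * 'rV[R]_d) :=
  `[(1 + c)^-1 + k.+1%:R^-1, 1]%classic `*` cube 0 k%:R.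
pose S k := [set x : 'M[R]_(n, d) | exists2 p : R * 'rV[R]_d, C k p &
   sandwich_center K (fun i => row i x) p.1 p.2].
have c1 : 0 < 1 + c by rewrite ltr_pwDl // ltW.
have -> : [set w | (c%:E <= dist_L (random_hull X w) K)%E] =
    ~` (\bigcup_k (M @^-1` S k)).
  rewrite -[LHS]setCK; congr (~` _); apply/seteqP; split => w /=.
    move/negP; rewrite -ltNge => /ereal_inf_lt[_ [e [e0 [a ea]] <-]].
    rewrite lte_fin => ec.
    have e1 : 0 < 1 + e by rewrite ltr_pwDl.
    have gap : 0 < (1 + e)^-1 - (1 + c)^-1 by rewrite subr_gt0 ltf_pV2 // ltrD2l.
    have [k1 _ hk1] := near_infty_natSinv_lt (PosNum gap).
    have [k2 _ hk2] := nbhs_infty_ger `|a|.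
    pose k := maxn k1 k2; exists k => //; exists ((1 + e)^-1, a) => /=.
      split => /= [|j]; last first.
        rewrite mxE subr0; apply: le_trans (coord_le_norm _ _ _) _.
        by apply: hk2; rewrite /= leq_maxr.
      have /= := hk1 k (leq_maxl _ _); rewrite in_itv /= => h; apply/andP; split.
        by rewrite addrC -lerBrDr ltW.
      by rewrite invf_le1 // lerDl.
    by rewrite MX; apply/sandwich_centerP.
  case=> k _ [[r a] [/= ]]; rewrite in_itv /= => /andP[r0 r1] _; rewrite MX => h.
  apply/negP; rewrite -ltNge.
  have rc : (1 + c)^-1 < r.
    by apply: lt_le_trans r0; rewrite ltrDl invr_gt0 ltr0Sn.
  have rp : 0 < r by apply: lt_trans rc; rewrite invr_gt0.
  have e0 : 0 <= r^-1 - 1 by rewrite subr_ge0 invf_ge1.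
  apply: (@le_lt_trans _ _ (r^-1 - 1)%:E); last first.
    by rewrite lte_fin ltrBlDl -[1 + c]invrK ltf_pV2 // posrE invr_gt0.
  apply: ge_ereal_inf; exists (r^-1 - 1)%:E => //.
  exists (r^-1 - 1) => //; split => //; exists a.
  apply/sandwich_centerP => //.
  by rewrite [1 + _]addrC subrK invrK.
apply: measurableC; apply: bigcupT_measurable => k.
apply: (measurable_preimage_closed (f := M)).
  move=> i j; under eq_fun do rewrite mxE.
  exact: (measurableT_comp (measurable_rV_coord j)).
suff cC : compact (C k).
  exact: (closed_projection (@closed_sandwich_center R n d K cK) cC).
apply: compact_setX; first exact: segment_compact.
rewrite (_ : cube _ _ = [set v : 'rV[R]_d | forall i, `[- k%:R, k%:R]%classic (v ord0 i)]).
  by apply: (@rV_compact R d (fun=> `[- k%:R, k%:R]%classic)) => _; exact: segment_compact.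
by apply/seteqP; split => v /= h i; have := h i; rewrite mxE subr0 in_itv /= ler_norml.
Qed.

(** * Volume and centroid *)

Section volume.
Context (R : realType) (d : nat).
Implicit Types (A B K : set 'rV[R]_d) (a u y z : 'rV[R]_d).

Definition vol A : R := fine (lebesgue_rV d A).

Lemma sub_cube_lty A M : measurable A -> 0 < M -> A `<=` cube 0 M ->
  (lebesgue_rV d A < +oo)%E.
Proof.
move=> mA M0 AM; apply: (@le_lt_trans _ _ (lebesgue_rV d (cube 0 M))).
  by apply: le_measure; rewrite ?inE //; exact: measurable_cube.
by rewrite lebesgue_rV_cube // ltry.
Qed.

Section finite_volume.
Context K (mK : measurable K) (Koo : (lebesgue_rV d K < +oo)%E).

Lemma volE A : measurable A -> A `<=` K -> lebesgue_rV d A = (vol A)%:E.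
Proof.
move=> mA AK; rewrite fineK // ge0_fin_numE //.
by apply: le_lt_trans Koo; apply: le_measure; rewrite ?inE.
Qed.

Lemma le_vol A B : measurable A -> measurable B -> A `<=` B -> B `<=` K ->
  vol A <= vol B.
Proof.
move=> mA mB AB BK; rewrite -lee_fin -!volE //; last exact: subset_trans BK.
by apply: le_measure; rewrite ?inE.
Qed.

Lemma volD A B : measurable A -> measurable B -> A `<=` B -> B `<=` K ->
  vol (B `\` A) = vol B - vol A.
Proof.
move=> mA mB AB BK; have AK := subset_trans AB BK.
have BAK : B `\` A `<=` K by apply: subset_trans BK; exact: subDsetl.
have mBA := measurableD mB mA.
apply: EFin_inj; rewrite EFinB -!volE //.
rewrite measureD //; last by apply: le_lt_trans Koo; apply: le_measure; rewrite ?inE.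
by rewrite (setIidr AB).
Qed.

End finite_volume.

Lemma vol_homothety A z (r : R) : 0 < r -> measurable A ->
  (lebesgue_rV d A < +oo)%E ->
  vol ((fun x => r^-1 *: (x - z)) @^-1` A) = r ^+ d * vol A.
Proof.
move=> r0 mA Aoo; rewrite /vol lebesgue_rV_homothety // fineM //.
by rewrite ge0_fin_numE.
Qed.

End volume.

(** What is used of a centroid, stated with volumes instead of integrals. *)
Definition balanced (R : realType) (d : nat) (K : set 'rV[R]_d) (a : 'rV[R]_d) :
    Prop :=
  forall (u : 'rV[R]_d) A (b : R), measurable A -> A `<=` K ->
    (forall y, K y -> dot u (y - a) <= 1) ->
    (forall y, A y -> dot u (y - a) <= b) ->
    0 <= b * vol A + (vol K - vol A).

Section centroid.
Context (R : realType) (d : nat) (K : set 'rV[R]_d) (M : R).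
Context (mK : measurable K) (M0 : 0 < M) (KM : K `<=` cube 0 M).
Context (K0 : 0 < vol K).

Let mu : {measure set 'rV[R]_d -> \bar R} := lebesgue_rV d.
Let Koo : (mu K < +oo)%E := sub_cube_lty mK M0 KM.

Let integrable_bounded (f : 'rV[R]_d -> R) (C : R) : measurable_fun setT f ->
  (forall y, K y -> `|f y| <= C) -> mu.-integrable K (EFin \o f).
Proof.
move=> mf fC; apply: measurable_bounded_integrable => //.
  exact: measurable_funTS.
exists C; split => [|r Cr y Ky]; first exact: num_real.
by apply: le_trans (ltW Cr); exact: fC.
Qed.

Let integrable_coord i : mu.-integrable K (EFin \o (fun y : 'rV[R]_d => y ord0 i)).
Proof.
apply: (@integrable_bounded _ M); first exact: measurable_rV_coord.
by move=> y /KM/(_ i); rewrite mxE subr0.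
Qed.

Let integrable_cst (r : R) : mu.-integrable K (EFin \o (fun=> r)).
Proof. by apply: (@integrable_bounded _ `|r|). Qed.

Let integrable_dot (u : 'rV[R]_d) : mu.-integrable K (EFin \o dot u).
Proof.
rewrite (_ : EFin \o _ = fun y : 'rV[R]_d =>
    (\sum_(i < d) (u ord0 i)%:E * (y ord0 i)%:E)%E); last first.
  by apply/funext => y /=; rewrite /dot -sumEFin.
apply: integrable_sum => // i _; apply: integrableZl => //; exact: integrable_coord.
Qed.

Let Rintegral_dot (u : 'rV[R]_d) :
  (\int[mu]_(y in K) dot u y = \sum_i u ord0 i * \int[mu]_(y in K) y ord0 i)%R.
Proof.
rewrite /Rintegral.
rewrite (_ : (fun y => (dot u y)%:E) = fun y : 'rV[R]_d =>
    (\sum_(i < d) (u ord0 i)%:E * (y ord0 i)%:E)%E); last first.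
  by apply/funext => y /=; rewrite /dot -sumEFin.
rewrite integral_sum // => [|i]; last first.
  by apply: integrableZl => //; exact: integrable_coord.
rewrite -sum_fine => [|i _]; last first.
  by apply: integrable_fin_num => //; apply: integrableZl => //; exact: integrable_coord.
apply: eq_bigr => i _; rewrite integralZl //; last exact: integrable_coord.
rewrite fineM //; apply: integrable_fin_num => //; exact: integrable_coord.
Qed.

(** The centroid is balanced: the function [y |-> dot u (y - a)] has integral zero
    over [K], and the bound integrates it over [A] and over the rest of [K]
    separately. *)
Lemma exists_balanced : exists a, balanced K a.
Proof.
exists (\row_i ((\int[mu]_(y in K) y ord0 i)%R / vol K)).
set a := (X in balanced K X).
move=> u A b mA AK f1 fb; pose f y := dot u (y - a).
have fE : f = (fun y => dot u y - dot u a) by apply/funext => y; rewrite /f !dotE.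
have If : mu.-integrable K (EFin \o f).
  rewrite fE (_ : EFin \o _ = (EFin \o dot u) \- (EFin \o (fun=> dot u a)))%E //.
  by apply: integrableB.
have f0 : (\int[mu]_(y in K) f y = 0)%R.
  rewrite fE (RintegralB mK (integrable_dot u) (integrable_cst _)).
  rewrite Rintegral_dot Rintegral_cst // -/(vol K) /dot mulr_suml -sumrB big1 // => i _.
  by rewrite mxE -mulrA mulfVK ?gt_eqF // subrr.
have KE : K = A `|` (K `\` A) by rewrite setDUK.
have mKA := measurableD mK mA.
have IfA : mu.-integrable A (EFin \o f) by exact: integrableS If.
have IfKA : mu.-integrable (K `\` A) (EFin \o f).
  by apply: integrableS If => //; exact: subDsetl.
rewrite -f0 [X in (\int[mu]_(y in X) f y)%R]KE Rintegral_setU //; last 2 first.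
- by rewrite -KE.
- by apply/disj_setPS => y [Ay [_ /(_ Ay)]].
rewrite -(volD mK Koo) // -(mul1r (vol (_ `\` _))) lerD //.
  rewrite -(Rintegral_cst _ mA) le_Rintegral //.
  by apply: integrableS (integrable_cst b).
rewrite -(Rintegral_cst _ mKA) le_Rintegral //.
  by apply: integrableS (integrable_cst 1) => //; exact: subDsetl.
by move=> y [Ky _]; exact: f1.
Qed.

End centroid.

(** * Packing nets *)

Section contraction.
Context (R : realType) (d : nat).
Implicit Types (A B K : set 'rV[R]_d) (w y : 'rV[R]_d).

(** The homothetic copy [(1 - r) w + r B]. *)
Definition contraction w (r : R) B : set 'rV[R]_d :=
  (fun y => r^-1 *: (y - (1 - r) *: w)) @^-1` B.

Lemma contractionP w r B y : r != 0 -> contraction w r B y ->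
  exists2 x, B x & y = r *: x + (1 - r) *: w.
Proof.
move=> r0 By; exists (r^-1 *: (y - (1 - r) *: w)) => //.
by rewrite scalerA mulfV // scale1r subrK.
Qed.

Lemma measurable_contraction w r B : measurable B -> measurable (contraction w r B).
Proof.
by move=> mB; rewrite -[X in measurable X]setTI; exact: measurable_homothety.
Qed.

Lemma contraction_sub K w r B : convex_set K -> K w -> B `<=` K -> 0 < r <= 1 ->
  contraction w r B `<=` K.
Proof.
move=> /convex_setP cK Kw BK /andP[r0 r1] y /contractionP[|x Bx ->].
  by rewrite gt_eqF.
by apply: cK => //; [exact: BK|rewrite ltW].
Qed.

End contraction.

(** The copies of [C] contracted towards points of [C] lie in [C], so that at
    most [s ^- d] of them can be disjoint.  In a maximal disjoint family with
    centres in [D], the copy at any other [v] in [D] meets one of the family. *)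
Lemma packing_net (R : realType) (d : nat) (C D : set 'rV[R]_d) (s : R) :
  measurable C -> convex_set C -> (lebesgue_rV d C < +oo)%E -> 0 < vol C ->
  D `<=` C -> 0 < s <= 1 ->
  exists (k : nat) (u : 'I_k -> 'rV[R]_d),
    [/\ k%:R * s ^+ d <= 1, forall i, D (u i) &
        forall v, D v -> exists i p q, [/\ C p, C q &
          (1 - s) *: v + s *: p = (1 - s) *: u i + s *: q]].
Proof.
move=> mC cvC Coo C0 DC s01; have /andP[s0 s1] := s01.
have sn0 : s != 0 by rewrite gt_eqF.
have sd0 : 0 < s ^+ d by rewrite exprn_gt0.
pose P k := `[< exists u : 'I_k -> 'rV[R]_d, (forall i, D (u i)) /\
  trivIset setT (fun i => contraction (u i) s C) >].
have Pbound k : P k -> k%:R * s ^+ d <= 1.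
  move=> /asboolP[u [Du tu]].
  have mu i : measurable (contraction (u i) s C) by exact: measurable_contraction.
  have uC i : contraction (u i) s C `<=` C.
    by apply: contraction_sub => //; exact: DC.
  have mU : measurable (\big[setU/set0]_(i < k) contraction (u i) s C).
    by apply: bigsetU_measurable.
  have : (lebesgue_rV d (\big[setU/set0]_(i < k) contraction (u i) s C) <=
          lebesgue_rV d C)%E.
    apply: le_measure; rewrite ?inE //.
    apply: (big_ind (fun A : set 'rV[R]_d => A `<=` C)) => [//|A B AC BC|i _].
      by rewrite subUset.
    exact: uC.
  rewrite measure_semi_additive_ord //.
  rewrite (eq_bigr (fun=> (s ^+ d * vol C)%:E)) => [|i _]; last first.
    by rewrite [LHS](volE mC Coo (mu i) (uC i)) vol_homothety.
  rewrite sumEFin sumr_const card_ord (volE mC Coo mC) // lee_fin.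
  by rewrite -[_ * vol C *+ k]mulr_natl mulrA ger_pMl.
have P0 : exists k, P k.
  exists 0%N; apply/asboolP; exists (fun=> 0); split; first by case.
  by move=> [].
have Pmax k : P k -> (k <= Num.trunc (s ^+ d)^-1)%N.
  move=> /Pbound; rewrite -ler_pdivlMr // mul1r => h.
  by rewrite truncn_ge_nat // invr_ge0 ltW.
case: (ex_maxnP P0 Pmax) => k Pk kmax; exists k.
have /asboolP[u [Du tu]] := Pk; exists u; split => //; first exact: Pbound.
move=> v Dv; apply: contrapT => hv.
suff /kmax : P k.+1 by rewrite ltnn.
pose u' (i : 'I_k.+1) := if unlift ord0 i is Some j then u j else v.
have dis i : contraction v s C `&` contraction (u i) s C = set0.
  rewrite -subset0 => y [/(contractionP sn0)[p Cp yp] /(contractionP sn0)[q Cq yq]].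
  by apply: hv; exists i, p, q; split => //; rewrite addrC -yp yq addrC.
apply/asboolP; exists u'; split => [i|].
  by rewrite /u'; case: unliftP.
apply/trivIsetP => i j _ _ ; rewrite /u'.
case: (unliftP ord0 i) => [i'|] ->; case: (unliftP ord0 j) => [j'|] -> //.
- by move=> ij; move/trivIsetP : tu; apply => //; apply: contra_neq ij => ->.
- by rewrite setIC.
Qed.

(** * Caps of a convex body around its centroid *)

Lemma bernoulli_inequality (R : realDomainType) (h : R) (k : nat) :
  0 <= h <= 1 -> 1 - k%:R * h <= (1 - h) ^+ k.
Proof.
move=> /andP[h0 h1]; have h1' : 0 <= 1 - h by rewrite subr_ge0.
elim: k => [|k IH]; first by rewrite mul0r subr0 expr0.
rewrite exprS; have := ler_wpM2l h1' IH.
have := mulr_ge0 (ler0n R k) (sqr_ge0 h); rewrite -natr1; nra.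
Qed.

Section body_geometry.
Context (R : realType) (d : nat) (d_gt0 : (0 < d)%N).
Context (K : set 'rV[R]_d) (coK : compact K) (cvK : convex_set K).
Context (M : R) (M0 : 0 < M) (KM : K `<=` cube 0 M).
Context (z0 : 'rV[R]_d) (r0 : R) (r0_gt0 : 0 < r0) (z0K : cube z0 r0 `<=` K).
Context (a : 'rV[R]_d).

Let cK : closed K.
Proof. by apply: compact_closed => //; exact: norm_hausdorff. Qed.
Let mK : measurable K := closed_measurable_rV cK.
Let Koo := sub_cube_lty mK M0 KM.

Let Kz0 : K z0.
Proof. by apply: z0K => i; rewrite subrr normr0 ltW. Qed.

Let d0 : 0 < d%:R :> R. Proof. by rewrite ltr0n. Qed.
Let d1 : 1 <= d%:R :> R. Proof. by rewrite ler1n. Qed.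

Lemma vol_body_gt0 : 0 < vol K.
Proof.
apply: (@lt_le_trans _ _ (vol (cube z0 r0))).
  by rewrite /vol lebesgue_rV_cube //= exprn_gt0 // mulr_gt0.
by apply: (le_vol mK Koo) => //; exact: measurable_cube.
Qed.

Let V := vol K.
Let V0 : 0 < V := vol_body_gt0.

Context (a_centroid : balanced K a).

Definition polar : set 'rV[R]_d := [set u | forall y, K y -> dot u (y - a) <= 1].

Lemma dot_affine u x w (r : R) :
  dot u (r *: x + (1 - r) *: w - a) = r * dot u (x - a) + (1 - r) * dot u (w - a).
Proof. rewrite !dotE; ring. Qed.

Let vol_contraction w r B : measurable B -> B `<=` K -> 0 < r ->
  vol (contraction w r B) = r ^+ d * vol B.
Proof.
move=> mB BK r_gt0; apply: vol_homothety => //.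
by apply: le_lt_trans Koo; apply: le_measure; rewrite ?inE.
Qed.

(** If [dot u (y - a)] were lower, then on the copy of [K] contracted towards [y]
    by the factor [1 - 1/(2 * d)], which keeps at least half of the volume, the
    function would be so negative that its mean could not be zero. *)
Lemma polar_lower_bound u y : polar u -> K y -> 1 - 4 * d%:R <= dot u (y - a).
Proof.
move=> pu Ky; set f := dot u (y - a).
pose h : R := (2 * d%:R)^-1.
have h0 : 0 < h by rewrite invr_gt0 mulr_gt0.
have hd : h * d%:R = 2^-1 by rewrite /h invfM mulfVK // gt_eqF.
have h1 : h <= 2^-1 by rewrite -hd ler_peMr // ltW.
have hh : 0 < 1 - h <= 1 by lra.
have hd2 : 2^-1 <= (1 - h) ^+ d.
  have h01 : 0 <= h <= 1 by lra.
  by have := bernoulli_inequality d h01; rewrite mulrC hd; lra.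
have := a_centroid (measurable_contraction y (1 - h) mK)
  (contraction_sub cvK Ky (fun x Kx => Kx) hh) pu (b := 1 - h + h * f).
have -> : vol (contraction y (1 - h) K) = (1 - h) ^+ d * V.
  by apply: vol_contraction => //; case/andP: hh.
set q := (1 - h) ^+ d in hd2 *.
have h2 : forall x, contraction y (1 - h) K x -> dot u (x - a) <= 1 - h + h * f.
  move=> x /contractionP[|k Kk ->]; first by rewrite gt_eqF //; case/andP: hh.
  rewrite dot_affine subKr lerD2r ger_pMr ?pu //; by case/andP: hh.
move=> /(_ h2); rewrite -/V => bal.
have bal' : 0 <= 1 - h * q * (1 - f).
  have : 0 <= (1 - h * q * (1 - f)) * V by move: bal; lra.
  by rewrite pmulr_lge0.
rewrite leNgt; apply/negP => fl.
have : 1 < h * q * (1 - f).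
  have : h * q * (4 * d%:R) < h * q * (1 - f).
    by rewrite ltr_pM2l; [lra|rewrite mulr_gt0 //; lra].
  have -> : h * q * (4 * d%:R) = 4 * q * (h * d%:R) by ring.
  by rewrite hd; lra.
lra.
Qed.

Definition upper_part u (c : R) : set 'rV[R]_d :=
  K `&` [set y | c <= dot u (y - a)].

Lemma measurable_upper_part u c : measurable (upper_part u c).
Proof.
apply: closed_measurable_rV; apply: closedI => //.
rewrite (_ : [set y | _] = dot u @^-1` [set t | c + dot u a <= t]).
  apply: preimage_closed; last exact: closed_ge.
  move=> y _; apply: (continuous_dot (f := fun=> u) (g := id)).
    exact: cst_continuous.
  by move=> x; exact: cvg_id.
by apply/seteqP; split => y /=; rewrite !dotE; lra.
Qed.

(** Markov's inequality for a function of mean zero that is at most 1. *)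
Lemma half_above_neg1 u : polar u -> V / 2 <= vol (upper_part u (-1)).
Proof.
move=> pu; set U := upper_part u (-1).
have mU : measurable U by exact: measurable_upper_part.
have UK : U `<=` K by move=> y [].
have h : forall y, (K `\` U) y -> dot u (y - a) <= -1.
  move=> y [Ky Uy]; rewrite leNgt; apply/negP => yy; apply: Uy; split => //=.
  exact: ltW.
have := a_centroid (measurableD mK mU) (@subDsetl _ K U) pu h.
by rewrite (volD mK Koo mU mK UK (fun x Kx => Kx)) -/V; lra.
Qed.

(** The cap contains the copy, contracted by [tau] towards its extreme point, of
    the part of [K] above level -1. *)
Lemma cap_volume u z (tau : R) : polar u -> K z -> dot u (z - a) = 1 ->
  0 < tau <= 1 -> tau ^+ d * (V / 2) <= vol (upper_part u (1 - 2 * tau)).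
Proof.
move=> pu Kz uz tau01; have /andP[tau0 tau1] := tau01.
set B := upper_part u (-1).
have mB : measurable B by exact: measurable_upper_part.
have BK : B `<=` K by move=> y [].
apply: (@le_trans _ _ (tau ^+ d * vol B)).
  by rewrite ler_pM2l ?exprn_gt0 //; exact: half_above_neg1.
rewrite -(vol_contraction z mB BK tau0); apply: (le_vol mK Koo).
- exact: measurable_contraction.
- exact: measurable_upper_part.
- move=> y yB; split; first exact: (contraction_sub cvK Kz BK tau01).
  have [|x [Kx /= fx] ->] := contractionP _ yB; first by rewrite gt_eqF.
  by rewrite /= dot_affine uz; nra.
- by move=> y [].
Qed.

Lemma closed_polar : closed polar.
Proof.
have -> : polar = \bigcap_(y in K)
    (fun u : 'rV[R]_d => dot u (y - a)) @^-1` [set t | t <= 1].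
  by apply/seteqP; split => u pu y Ky; exact: pu.
apply: closed_bigI => y _; apply: preimage_closed; last exact: closed_le.
move=> u _; apply: (continuous_dot (f := id) (g := fun=> y - a)).
  by move=> x; exact: cvg_id.
exact: cst_continuous.
Qed.

Lemma convex_polar : convex_set polar.
Proof.
apply/convex_setP => u v t pu pv /andP[t0 t1] y Ky.
have t1' : 0 <= 1 - t by rewrite subr_ge0.
rewrite dotDl !dotZl; have := ler_wpM2l t0 (pu y Ky).
have := ler_wpM2l t1' (pv y Ky); lra.
Qed.

(** The function [y |-> dot u (y - a)] varies by at most [4 * d] on [K], which
    contains segments of length [2 * r0] in all coordinate directions. *)
Lemma polar_sub_cube : polar `<=` cube 0 (2 * d%:R / r0).
Proof.
move=> u pu i; rewrite mxE subr0.
have Kp (e : R) : `|e| <= r0 -> K (z0 + e *: delta_mx ord0 i).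
  move=> er; apply: z0K => j; rewrite !mxE eqxx /= addrAC subrr add0r.
  by case: (j == i); rewrite ?mulr1 // mulr0 normr0 ltW.
have Kp1 := Kp r0; have Kp2 := Kp (- r0).
rewrite normrN gtr0_norm // in Kp1 Kp2.
have := polar_lower_bound pu (Kp1 (lexx _)); have := pu _ (Kp1 (lexx _)).
have := polar_lower_bound pu (Kp2 (lexx _)); have := pu _ (Kp2 (lexx _)).
rewrite !dotE dot_delta => h1 h2 h3 h4.
by rewrite ler_norml -mulNr ler_pdivrMr // ler_pdivlMr //; apply/andP; split; lra.
Qed.

Lemma polar_measure : [/\ measurable polar, (lebesgue_rV d polar < +oo)%E &
  0 < vol polar].
Proof.
have mp := closed_measurable_rV closed_polar.
have Bp : 0 < 2 * d%:R / r0 by rewrite divr_gt0 // mulr_gt0.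
have poo := sub_cube_lty mp Bp polar_sub_cube.
split => //.
pose B := d%:R * (M + `|a|).
have B0 : 0 < B by rewrite mulr_gt0 // ltr_wpDr.
apply: (@lt_le_trans _ _ (vol (cube (0 : 'rV[R]_d) B^-1))).
  by rewrite /vol lebesgue_rV_cube ?invr_gt0 //= exprn_gt0 // mulr_gt0 // invr_gt0.
apply: (le_vol mp poo) => //; first exact: measurable_cube.
move=> u uB y Ky; rewrite /dot.
apply: (@le_trans _ _ (\sum_(i < d) B^-1 * (M + `|a|))).
  apply: ler_sum => i _; apply: le_trans (ler_norm _) _; rewrite normrM ler_pM //.
    by have := uB i; rewrite mxE subr0.
  rewrite !mxE; apply: le_trans (ler_normB _ _) _; apply: lerD.
    by have := KM Ky i; rewrite mxE subr0.
  exact: coord_le_norm.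
rewrite sumr_const card_ord -mulr_natl mulrCA -/B mulVf //.
by rewrite gt_eqF.
Qed.

(** A direction that is nonpositive on [K - a] has all its positive multiples in
    the polar body, so that [polar_lower_bound] makes it vanish on [K - a]. *)
Lemma exists_positive u : u != 0 -> exists2 y, K y & 0 < dot u (y - a).
Proof.
move=> u0; apply: contrapT => hn.
have fle y : K y -> dot u (y - a) <= 0.
  by move=> Ky; rewrite leNgt; apply/negP => yy; apply: hn; exists y.
have fge y : K y -> 0 <= dot u (y - a).
  move=> Ky; rewrite leNgt; apply/negP => yy.
  pose c := 4 * d%:R / - dot u (y - a).
  have c0 : 0 < c by rewrite divr_gt0 ?oppr_gt0 // mulr_gt0.
  have pc : polar (c *: u).
    move=> x Kx; rewrite dotZl; apply: le_trans (ler01 : (0 : R) <= 1).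
    by rewrite pmulr_rle0 ?fle.
  have := polar_lower_bound pc Ky; rewrite dotZl /c.
  have -> : 4 * d%:R / - dot u (y - a) * dot u (y - a) = - (4 * d%:R).
    by field; rewrite lt_eqF.
  lra.
have f0 y : K y -> dot u (y - a) = 0 by move=> Ky; apply/eqP; rewrite eq_le fle ?fge.
case/negP: u0; apply/eqP/rowP => i; rewrite mxE.
have Kp : K (z0 + r0 *: delta_mx ord0 i).
  apply: z0K => j; rewrite !mxE eqxx /= addrAC subrr add0r.
  by case: (j == i); rewrite ?mulr1 ?mulr0 ?normr0 ?(gtr0_norm r0_gt0) // ltW.
have := f0 _ Kp; have := f0 _ Kz0; rewrite !dotE dot_delta => h1 h2.
have : r0 * u ord0 i = 0 by lra.
by move/eqP; rewrite mulf_eq0 gt_eqF //= => /eqP.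
Qed.

Lemma centroid_mem : K a.
Proof.
apply: contrapT => Ka; have [u hu] := strict_separation coK cvK Ka.
have [u0|u0] := eqVneq u 0; first by have := hu _ Kz0; rewrite u0 -(scale0r 0) !dotE; lra.
have [y Ky] := exists_positive u0; have := hu y Ky; rewrite !dotE; lra.
Qed.

Definition polar_boundary : set 'rV[R]_d :=
  [set u | polar u /\ exists2 z, K z & dot u (z - a) = 1].

(** On [K], two elements of the polar body differ by at most [4 * d], so a
    normalised direction differs from its neighbour in the net by at most
    [4 * d * s / (1 - s)], which is the allowance [t2 - t1] between the depths. *)
Lemma net_sandwich (n k : nat) (x : 'I_n -> 'rV[R]_d) (u : 'I_k -> 'rV[R]_d)
    (s t1 t2 : R) :
  (0 < n)%N -> (forall j, K (x j)) -> 0 < s -> s < 1 -> t2 <= 1 -> 0 <= t2 ->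
  4 * d%:R * s <= (t2 - t1) * (1 - s) ->
  (forall v, polar_boundary v -> exists i p q, [/\ polar p, polar q &
     (1 - s) *: v + s *: p = (1 - s) *: u i + s *: q]) ->
  (forall i, exists j, upper_part (u i) (1 - t1) (x j)) ->
  sandwich_center K x (1 - t2) a.
Proof.
move=> n0 Kx s0 s1 t21 t20 st net hit; split => [j|y v Ky].
  have /convex_setP/(_ (x j) a (1 - t2) (Kx j) centroid_mem) := cvK.
  have -> : 0 <= 1 - t2 <= 1 by lra.
  move=> /(_ isT); congr K; apply/rowP => i; rewrite !mxE; ring.
apply: contrapT => hn.
have miss j : dot v (x j - a) < (1 - t2) * dot v (y - a).
  rewrite ltNge; apply/negP => h; apply: hn; exists j; move: h; rewrite !dotE; lra.
have v0 : v != 0.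
  apply/eqP => v0; have := miss (Ordinal n0).
  by rewrite v0 -(scale0r 0) !dotZl !mul0r mulr0 ltxx.
have cf : continuous (fun w : 'rV[R]_d => dot v (w - a)).
  apply: continuous_dot; first exact: cst_continuous.
  by move=> w; apply: (@continuousB _ _ _ id (cst a)); [exact: cvg_id|exact: cst_continuous].
have K0 : K !=set0 by exists z0.
have [z /set_mem Kz zmax] := compact_EVT_max K0 coK (continuous_subspaceT cf).
have [y1 Ky1 y1pos] := exists_positive v0.
have m0 : 0 < dot v (z - a) by apply: lt_le_trans (zmax y1 _); rewrite ?inE.
set m := dot v (z - a) in m0 zmax.
have bv : polar_boundary (m^-1 *: v).
  split; last by exists z => //; rewrite dotZl mulVf // gt_eqF.
  by move=> w Kw; rewrite dotZl mulrC ler_pdivrMr // mul1r zmax // inE.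
have [i [p [q [pp pq eq]]]] := net _ bv.
have [j [_ /= hj]] := hit i.
have := congr1 (fun w => dot w (x j - a)) eq; rewrite !dotDl !dotZl.
have := pp _ (Kx j); have := polar_lower_bound pq (Kx j).
set P := dot p _; set Q := dot q _; set F := dot v _; set G := dot (u i) _.
move=> hQ hP e.
have hF : m^-1 * F < 1 - t2.
  rewrite mulrC ltr_pdivrMr //; apply: lt_le_trans (miss j) _.
  by rewrite ler_wpM2l ?subr_ge0 // zmax // inE.
have s1' : 0 < 1 - s by rewrite subr_gt0.
have e1 : (1 - s) * (m^-1 * F) < (1 - s) * (1 - t2) by rewrite ltr_pM2l.
have e2 : (1 - s) * (1 - t1) <= (1 - s) * G by rewrite ler_pM2l.
have e3 : s * (P - Q) <= s * (4 * d%:R) by rewrite ler_pM2l //; lra.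
lra.
Qed.

End body_geometry.

(** * Random samples *)

Lemma union_bound (R : realType) (disp : measure_display) (T : measurableType disp)
    (mu : {measure set T -> \bar R}) (k : nat) (F : 'I_k -> set T) (E : set T)
    (c : R) :
  (forall i, measurable (F i)) -> measurable E ->
  (forall w, E w -> exists i, F i w) -> (forall i, (mu (F i) <= c%:E)%E) ->
  (mu E <= (k%:R * c)%:E)%E.
Proof.
move=> mF mE EF Fc.
pose G m := if insub m is Some i then F i else set0.
have GF (i : 'I_k) : G i = F i by rewrite /G valK.
have mG m : measurable (G m) by rewrite /G; case: insub.
apply: (@le_trans _ _ (mu (\big[setU/set0]_(i < k) G i))).
  apply: le_measure; rewrite ?inE //; first exact: bigsetU_measurable.
  by move=> w /EF[i Fi]; apply: (bigsetU_sup (ltn_ord i)); rewrite GF.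
apply: le_trans (Boole_inequality mu (fun i _ => mG i)) _.
apply: (@le_trans _ _ (\sum_(i < k) c%:E)%E).
  by apply: lee_sum => i _; rewrite GF; exact: Fc.
by rewrite sumEFin lee_fin sumr_const card_ord mulr_natl.
Qed.

Section random_sample.
Context (R : realType) (d n : nat) (disp : measure_display)
  (T : measurableType disp) (X : 'I_n -> {mfun T >-> 'rV[R]_d})
  (P : probability T R) (K : set 'rV[R]_d).
Context (mK : measurable K) (Koo : (lebesgue_rV d K < +oo)%E) (K0 : 0 < vol K).
Context (iidX : iid_uniform K P X).

Lemma measurable_preimage_sample j B : measurable B -> measurable (X j @^-1` B).
Proof.
by move=> mB; rewrite -[X in measurable X]setTI; apply: measurable_funP.
Qed.

Lemma uniform_outside j U : measurable U -> U `<=` K ->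
  P (X j @^-1` (~` U)) = (1 - vol U / vol K)%:E.
Proof.
move=> mU UK; have := iidX.2 j _ (measurableC mU).
rewrite /distribution /pushforward => ->; rewrite -setDE.
rewrite (volE mK Koo (measurableD mK mU) (@subDsetl _ K U)).
rewrite (volE mK Koo mK (fun x Kx => Kx)) (volD mK Koo mU mK UK (fun x Kx => Kx)).
by rewrite inver gt_eqF // -EFinM mulrBl divff // gt_eqF.
Qed.

Lemma sample_misses U : measurable U -> U `<=` K ->
  P (\bigcap_j (X j @^-1` (~` U))) = ((1 - vol U / vol K) ^+ n)%:E.
Proof.
move=> mU UK.
have := iidX.1 [set: 'I_n]%SET (fun=> ~` U) (fun=> measurableC mU).
rewrite (_ : [set` [set: 'I_n]%SET] = setT); last by apply/seteqP; split => // i _ /=; rewrite inE.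
move=> ->; rewrite (eq_bigr (fun=> (1 - vol U / vol K)%:E)) => [|j _]; last first.
  exact: uniform_outside.
by rewrite prodEFin prodr_const cardsT card_ord.
Qed.

End random_sample.

(** * Volumes of Euclidean balls *)

Section euclidean_balls.
Context (R : realType).

Definition unit_ball (d : nat) : set 'rV[R]_d := [set v | norm2 v <= 1].

Lemma unit_ballE d (v : 'rV[R]_d) : unit_ball v <-> dot v v <= 1.
Proof.
by rewrite /unit_ball /= /norm2 -[X in _ <= X]sqrtr1 ler_sqrt.
Qed.

Lemma measurable_unit_ball d : measurable (@unit_ball d).
Proof.
apply: closed_measurable_rV.
rewrite (_ : @unit_ball d = (fun v => dot v v) @^-1` [set t | t <= 1]).
  apply: preimage_closed; last exact: closed_le.
  by move=> v _; apply: (continuous_dot (f := id) (g := id)) => x; exact: cvg_id.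
by apply/seteqP; split => v /unit_ballE.
Qed.

Lemma unit_ball_sub_cube d : @unit_ball d `<=` cube 0 1.
Proof.
move=> v /unit_ballE vv i; rewrite mxE subr0.
have : v ord0 i ^+ 2 <= 1.
  apply: le_trans vv; rewrite /dot (bigD1 i) //= -expr2 lerDl.
  by apply: sumr_ge0 => j _; rewrite -expr2 sqr_ge0.
by rewrite -real_normK ?num_real // expr_le1.
Qed.

Let unit_ball_lty d := sub_cube_lty (@measurable_unit_ball d) ltr01
  (@unit_ball_sub_cube d).

(** The ball of dimension [d + 1] contains the cylinder of half-height
    [1/(2(d + 1))] over the concentric ball of radius [1 - 1/(2(d + 1))], whose
    volume is at least half that of the unit ball of dimension [d]. *)
Lemma kappa_ratio d : kappa d <= 2 * d.+1%:R * kappa d.+1 :> R.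
Proof.
pose h : R := (2 * d.+1%:R)^-1.
have n0 : 0 < d.+1%:R :> R by rewrite ltr0Sn.
have h0 : 0 < h by rewrite invr_gt0 mulr_gt0.
have hd : h * d.+1%:R = 2^-1 by rewrite /h invfM mulfVK // gt_eqF.
have h1 : h <= 2^-1 by rewrite -hd ler_peMr ?ler1n // ltW.
pose B := (fun x => (1 - h)^-1 *: (x - 0)) @^-1` (@unit_ball d).
have mB : measurable B.
  by rewrite -[X in measurable X]setTI; apply: measurable_homothety => //;
    exact: measurable_unit_ball.
pose C : set 'rV[R]_d.+1 := (@uncons_rV R d) @^-1` (`[- h, h]%classic `*` B).
have mC : measurable C.
  rewrite -[X in measurable X]setTI; apply: measurable_uncons_rV => //.
  exact: measurableX.
have CB : C `<=` @unit_ball d.+1.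
  move=> v [/=]; rewrite in_itv /= -ler_norml => vh; rewrite /B /= subr0.
  move=> /unit_ballE; rewrite !dotE => vB; apply/unit_ballE.
  rewrite /dot big_ord_recl -expr2 -real_normK ?num_real //.
  have e1 : `|v ord0 ord0| ^+ 2 <= h ^+ 2.
    by rewrite ler_pXn2r // nnegrE // ltW.
  set w := \row_j v ord0 (lift ord0 j) in vB.
  have -> : \sum_(i < d) v ord0 (lift ord0 i) * v ord0 (lift ord0 i) = dot w w.
    by apply: eq_bigr => i _; rewrite !mxE.
  have p0 : 0 < 1 - h by lra.
  have e2 : dot w w <= (1 - h) ^+ 2.
    move: vB; rewrite mulrA -invfM -expr2 mulrC ler_pdivrMr ?exprn_gt0 //.
    by rewrite mul1r.
  nra.
have VC : lebesgue_rV d.+1 C = (2 * h * ((1 - h) ^+ d * kappa d))%:E.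
  rewrite (lebesgue_rV_cons (B := `[- h, h]%classic) (C := B)) //; last first.
    by apply/funext => p; rewrite /C /preimage /mkset cons_rVK.
  rewrite lebesgue_measure_itv /= lte_fin ifT; last by lra.
  rewrite lebesgue_rV_homothety //; [|by lra|exact: measurable_unit_ball].
  rewrite (volE (@measurable_unit_ball d) (@unit_ball_lty d)) //.
    by rewrite -EFinB -!EFinM; congr (_%:E); rewrite opprK -mulr2n mulr_natl.
  exact: measurable_unit_ball.
have : (lebesgue_rV d.+1 C <= lebesgue_rV d.+1 (@unit_ball d.+1))%E.
  by apply: le_measure; rewrite ?inE //; exact: measurable_unit_ball.
rewrite VC (volE (@measurable_unit_ball d.+1) (@unit_ball_lty d.+1)) //; last first.
  exact: measurable_unit_ball.
rewrite lee_fin -/(kappa d.+1) => le1.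
have hd2 : 2^-1 <= (1 - h) ^+ d.
  have h01 : 0 <= h <= 1 by lra.
  by have := bernoulli_inequality d h01; move: hd; rewrite -natr1; lra.
have k0 : 0 <= kappa d :> R by rewrite /kappa fine_ge0.
have le2 : 2 * h * (2^-1 * kappa d) <= kappa d.+1.
  by apply: le_trans le1; rewrite ler_wpM2l // ?ler_wpM2r // mulr_ge0 // ltW.
have -> : kappa d = 2 * d.+1%:R * (2 * h * (2^-1 * kappa d)).
  have -> : 2 * d.+1%:R * (2 * h * (2^-1 * kappa d)) = 2 * (h * d.+1%:R) * kappa d.
    by field.
  by rewrite hd; field.
by rewrite ler_wpM2l // mulr_ge0 // ltW.
Qed.

End euclidean_balls.

(** * The deviation bound for one body *)

(** Outside the null event that a point falls out of [K], a deviation forces the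
    sample to miss one of the caps of depth [4 * d * delta] given by the net. *)
Lemma hull_deviation (R : realType) (d n : nat) (disp : measure_display)
    (T : measurableType disp) (X : 'I_n -> {mfun T >-> 'rV[R]_d})
    (P : probability T R) (K : set 'rV[R]_d) (delta : R) :
  (0 < d)%N -> (0 < n)%N -> convex_body K -> iid_uniform K P X ->
  0 < delta -> delta <= (16 * d%:R)^-1 ->
  (P [set w | (8 * d%:R * delta)%:E <= dist_L (random_hull X w) K] <=
   ((12 / delta) ^+ d * (1 - (2 * d%:R * delta) ^+ d / 2) ^+ n)%:E)%E.
Proof.
move=> d_gt0 n_gt0 [coK cvK [z0 Kz0]] iidX delta0 delta1.
have d1 : 1 <= d%:R :> R by rewrite ler1n.
have dd : 16 * (d%:R * delta) <= 1.
  by rewrite mulrA mulrC -ler_pdivlMr ?mul1r // mulr_gt0 // ltr0n.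
have dd0 : 0 < d%:R * delta by rewrite mulr_gt0 // ltr0n.
have ddd : delta <= d%:R * delta by rewrite ler_peMl // ltW.
have cK : closed K by apply: compact_closed => //; exact: norm_hausdorff.
have mK := closed_measurable_rV cK.
have [M M0 KM] := compact_sub_cube coK.
have Koo := sub_cube_lty mK M0 KM.
have [r0 r0_gt0 z0K] := interior_sub_cube Kz0.
have K0 := vol_body_gt0 coK M0 KM r0_gt0 z0K.
have [a ha] := exists_balanced mK M0 KM K0.
have [mp poo p0] := polar_measure d_gt0 coK cvK M0 KM r0_gt0 z0K ha.
have s01 : 0 < delta / 12 <= 1 by apply/andP; split; lra.
have bp : polar_boundary K a `<=` polar K a by move=> u [].
have [k [u [ks bu net]]] := packing_net mp (@convex_polar R d K a) poo p0 bp s01.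
(* The margin [t2 - t1 = d * delta] pays for the net of mesh [delta / 12], and
   [t2] is small enough for [t2 / (1 - t2)] to stay below [8 * d * delta]. *)
pose t1 := 4 * (d%:R * delta); pose t2 := 5 * (d%:R * delta).
pose U i := upper_part K a (u i) (1 - t1).
have mU i : measurable (U i) by exact: measurable_upper_part.
have UK i : U i `<=` K by move=> y [].
pose F i := \bigcap_j (X j @^-1` (~` U i)).
have mX j B : measurable B -> measurable (X j @^-1` B).
  exact: measurable_preimage_sample.
have mF i : measurable (F i).
  by apply: fin_bigcap_measurable => [|j _]; [exact: finite_finset|exact/mX/measurableC].
pose N := \bigcup_j (X j @^-1` (~` K)).
have mN : measurable N.
  by apply: fin_bigcup_measurable => [|j _]; [exact: finite_finset|exact/mX/measurableC].
set E := (X in P X).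
have mE : measurable E by exact: measurable_dist_L_ge.
have PN : (P N <= (n%:R * 0)%:E)%E.
  apply: (@union_bound _ _ _ _ n (fun j => X j @^-1` (~` K))) => //.
  - by move=> j; exact/mX/measurableC.
  - by move=> w [j _ ?]; exists j.
  - by move=> j; rewrite [leLHS](uniform_outside mK Koo K0 iidX j mK (@subset_refl _ K)) divff
      ?gt_eqF // subrr.
set q := 1 - (2 * d%:R * delta) ^+ d / 2.
have PF i : (P (F i) <= (q ^+ n)%:E)%E.
  rewrite [leLHS](sample_misses mK Koo K0 iidX (mU i) (UK i)) lee_fin.
  have [pu [z Kz uz]] := bu i.
  have tau01 : 0 < 2 * d%:R * delta <= 1 by apply/andP; split; lra.
  have := cap_volume coK cvK M0 KM ha pu Kz uz tau01.
  rewrite (_ : 1 - 2 * (2 * d%:R * delta) = 1 - t1); last by rewrite /t1; ring.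
  rewrite -/(U i) => capU.
  have UV : vol (U i) <= vol K by apply: (le_vol mK Koo).
  apply: lerXn2r; rewrite ?nnegrE.
  - by rewrite subr_ge0 ler_pdivrMr // mul1r.
  - have := exprn_ile1 d (ltW (andP tau01).1) (andP tau01).2.
    by rewrite /q; lra.
  - by rewrite /q lerD2l lerN2 ler_pdivlMr // mulrAC -mulrA.
have sub w : (E `\` N) w -> exists i, F i w.
  move=> [Ew Nw]; apply: contrapT => nF.
  have XK j : K (X j w) by apply: contrapT => nK; apply: Nw; exists j.
  have hit i : exists j, U i (X j w).
    apply: contrapT => nU; apply: nF; exists i => j _ /= Uj; apply: nU; by exists j.
  have t21 : t2 <= 1 by rewrite /t2; lra.
  have t20 : 0 <= t2 by rewrite /t2; lra.
  have ss : delta / 12 < 1 by lra.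
  have st : 4 * d%:R * (delta / 12) <= (t2 - t1) * (1 - delta / 12).
    rewrite /t1 /t2.
    have : d%:R * delta * delta <= d%:R * delta by rewrite ler_piMr; lra.
    lra.
  have := net_sandwich d_gt0 coK cvK M0 KM r0_gt0 z0K ha n_gt0 XK
    (andP s01).1 ss t21 t20 st net hit.
  pose e := t2 / (1 - t2).
  have t2p : 0 < 1 - t2 by rewrite /t2; lra.
  have -> : 1 - t2 = (1 + e)^-1 by rewrite /e; field; lra.
  have e0 : 0 <= e by rewrite divr_ge0 // ltW.
  move=> /(sandwich_centerP _ _ n_gt0 cvK e0) sw.
  have : (dist_L (random_hull X w) K <= e%:E)%E.
    by apply: ge_ereal_inf; exists e%:E => //; exists e => //; split => //; exists a.
  move=> /(le_trans Ew); rewrite lee_fin /e ler_pdivlMr // => h.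
  have : (8 - 40 * (d%:R * delta) - 5) * (d%:R * delta) <= 0 by move: h; rewrite /t2; lra.
  by rewrite pmulr_lle0 //; lra.
have PE : (P (E `\` N) <= (k%:R * q ^+ n)%:E)%E.
  by apply: (@union_bound _ _ _ _ k F) => //; exact: measurableD.
apply: (@le_trans _ _ (P ((E `\` N) `|` N))).
  apply: le_measure; rewrite ?inE //; first by apply: measurableU => //; exact: measurableD.
  by move=> w Ew; have [Nw|Nw] := pselect (N w); [right|left].
apply: le_trans (measureU2 _ (measurableD mE mN) mN) _.
apply: le_trans (leeD PE PN) _; rewrite mulr0 adde0 lee_fin.
rewrite ler_wpM2r //.
  rewrite exprn_ge0 // /q; have : (2 * d%:R * delta) ^+ d <= 1 by rewrite exprn_ile1; lra.
  lra.
rewrite -ler_pdivlMr ?exprn_gt0 // in ks; last by case/andP: s01.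
by rewrite -exprVn invf_div mul1r in ks.
Qed.

(** * The uniform bound *)

Lemma exprD_ge (R : realDomainType) (p q : R) (d : nat) :
  (0 < d)%N -> 0 <= p -> 0 <= q -> p ^+ d + q ^+ d <= (p + q) ^+ d.
Proof.
case: d => // d _ p0 q0; elim: d => [|d IH]; first by rewrite !expr1.
rewrite exprS (exprS q) (exprS (p + q)).
have pq := addr_ge0 p0 q0; apply: le_trans (ler_wpM2l pq IH).
have := mulr_ge0 p0 (exprn_ge0 d.+1 q0); have := mulr_ge0 q0 (exprn_ge0 d.+1 p0).
nra.
Qed.

Lemma ln_ge1BV (R : realType) (x : R) : 0 < x -> 1 - x^-1 <= ln x.
Proof.
move=> x0; have xV : 0 < x^-1 by rewrite invr_gt0.
have : ln (1 + (x^-1 - 1)) <= x^-1 - 1 by apply: le_ln1Dx; lra.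
by rewrite addrC subrK lnV ?posrE //; lra.
Qed.

(** The sizes 2 and 3 violate the hypothesis, and [ln 4 >= 1]. *)
Lemma ln_ge1_of_small_ratio (R : realType) (n : nat) :
  (1 < n)%N -> ln n%:R / n%:R <= 16^-1 :> R -> 1 <= ln n%:R :> R.
Proof.
move=> n1 h; have n0 : 0 < n%:R :> R by rewrite ltr0n (ltn_trans _ n1).
have l2 : 2^-1 <= ln 2 :> R by have := @ln_ge1BV R 2 (ltr0Sn _ _); lra.
have ln2n : ln 2 <= ln n%:R :> R by rewrite ler_ln ?posrE // ler_nat.
have n4 : (4 <= n)%N.
  rewrite leqNgt; apply/negP => n3.
  have : n%:R <= 3 :> R by rewrite ler_nat.
  by move: h; rewrite ler_pdivrMr //; lra.
have : ln (2 ^+ 2) <= ln n%:R :> R.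
  by rewrite ler_ln ?posrE ?exprn_gt0 // -natrX ler_nat.
by rewrite lnXn // mulr2n; lra.
Qed.

(** With [D = n * delta ^ d], the first factor is [12 ^ d * n / D], at most
    [12 ^ d * exp (ln n)], and the second is at most [exp (- (C * D))] for
    [C = (2 * d) ^ d / 2]; here [C * D] dominates [ln n + L * y]. *)
Lemma tail_bound (R : realType) (d n : nat) (delta y L : R) :
  (0 < n)%N -> 0 < delta -> (2 * d%:R * delta) ^+ d <= 2 ->
  1 <= ln (n%:R : R) -> 0 <= y -> ln n%:R + y <= n%:R * delta ^+ d ->
  1 <= (2 * d%:R) ^+ d / 2 :> R -> L <= (2 * d%:R) ^+ d / 2 ->
  (12 / delta) ^+ d * (1 - (2 * d%:R * delta) ^+ d / 2) ^+ n <=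
  12 ^+ d * expR (- (L * y)).
Proof.
move=> n0 delta0 small ln1 y0 D_ge C1 LC.
set C := (2 * d%:R) ^+ d / 2 in C1 LC *; set D := n%:R * delta ^+ d in D_ge *.
have nn0 : 0 < n%:R :> R by rewrite ltr0n.
have dd0 : 0 < delta ^+ d by rewrite exprn_gt0.
have -> : (2 * d%:R * delta) ^+ d / 2 = C * delta ^+ d.
  by rewrite exprMn mulrAC.
have miss : (1 - C * delta ^+ d) ^+ n <= expR (- (C * D)).
  have -> : - (C * D) = (- (C * delta ^+ d)) * n%:R by rewrite /D; ring.
  rewrite expRM_natr; apply: lerXn2r; rewrite ?nnegrE ?expR_ge0 //.
    by move: small; rewrite exprMn /C; lra.
  exact: expR_ge1Dx.
have net : (12 / delta) ^+ d <= 12 ^+ d * expR (ln n%:R).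
  rewrite lnK ?posrE // expr_div_n ler_pdivrMr // -mulrA ler_peMr ?exprn_ge0 //.
  by rewrite -/D; lra.
apply: (@le_trans _ _ (12 ^+ d * expR (ln n%:R) * expR (- (C * D)))).
  apply: ler_pM => //; first by rewrite exprn_ge0 // divr_ge0 // ltW.
  by rewrite exprn_ge0 //; move: small; rewrite exprMn /C; lra.
rewrite -mulrA -expRD ler_wpM2l ?exprn_ge0 // ler_expR.
have : C * (ln n%:R + y) <= C * D by rewrite ler_wpM2l //; lra.
have : L * y <= C * y by rewrite ler_wpM2r.
have : ln n%:R <= C * ln n%:R by rewrite ler_peMl //; lra.
lra.
Qed.

Theorem theorem8 (R : realType) (d n : nat)
    (d_gt0 : (0 < d)%N) (n_gt0 : (0 < n)%N)
    (disp : measure_display) (T : measurableType disp)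
    (X : 'I_n -> {mfun T >-> 'rV[R]_d})
    (P : set 'rV[R]_d -> probability T R)
    (iidX : forall K : set 'rV[R]_d, convex_body K -> iid_uniform K (P K) X) :
  let a_n : R := (ln n%:R / n%:R) `^ (d%:R^-1) in
  let b_n : R := n%:R `^ (- d%:R^-1) in
  let L : R := (2 * d%:R) ^+ d.-1 * kappa d.-1 / (3 * kappa d) in
  forall x : R, 0 <= x -> a_n + b_n * x <= (16 * d%:R)^-1 ->
  (ereal_sup [set P K [set w | (8 * d%:R * a_n + 8 * d%:R * b_n * x)%:E <=
                               dist_L (random_hull X w) K]
             | K in @convex_body R d]
   <= (12 ^+ d * expR (- (L * x ^+ d)))%:E)%E.
Proof.
move=> a_n b_n L x x0 small.
have d1 : 1 <= d%:R :> R by rewrite ler1n.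
have dne0 : d%:R != 0 :> R by rewrite pnatr_eq0 -lt0n.
have nn0 : 0 < n%:R :> R by rewrite ltr0n.
have dn0 : (d != 0)%N by rewrite -lt0n.
have C1 : 1 <= (2 * d%:R) ^+ d / 2 :> R.
  have : 2 * d%:R <= (2 * d%:R) ^+ d :> R.
    by rewrite -{1}(expr1 (2 * d%:R)) ler_weXn2l //; lra.
  lra.
have k0 p : 0 <= kappa p :> R by rewrite /kappa fine_ge0.
have L0 : 0 <= L.
  by rewrite divr_ge0 // mulr_ge0 // exprn_ge0 // mulr_ge0.
have LC : L <= (2 * d%:R) ^+ d / 3.
  have := @kappa_ratio R d.-1; rewrite prednK // => kr.
  have -> : (2 * d%:R) ^+ d = (2 * d%:R) ^+ d.-1 * (2 * d%:R) :> R.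
    by rewrite -exprSr prednK.
  rewrite /L -!mulrA ler_wpM2l ?exprn_ge0 ?mulr_ge0 // invfM mulrCA.
  rewrite (mulrA 2) (mulrC _ 3^-1) ler_wpM2l ?invr_ge0 //.
  have [->|kd0] := eqVneq (kappa d : R) 0; first by rewrite invr0 mulr0 mulr_ge0.
  by rewrite ler_pdivrMr // lt_def kd0 k0.
set delta := a_n + b_n * x in small.
have a0 : 0 <= a_n by exact: powR_ge0.
have b0 : 0 < b_n by exact: powR_gt0.
have ad : a_n ^+ d = ln n%:R / n%:R.
  rewrite -powR_mulrn ?powR_ge0 // -powRrM mulVf // powRr1 //.
  by rewrite divr_ge0 // ln_ge0 // ler1n.
have bd : b_n ^+ d = n%:R^-1.
  by rewrite -powR_mulrn ?powR_ge0 // -powRrM mulNr mulVf // powR_inv1 // ltW.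
have D_ge : ln n%:R + x ^+ d <= n%:R * delta ^+ d.
  have := exprD_ge d_gt0 a0 (mulr_ge0 (ltW b0) x0).
  rewrite exprMn ad bd -/delta => /(ler_wpM2l (ltW nn0)); apply: le_trans.
  by rewrite mulrDr !mulrA mulrAC divff ?gt_eqF // !mul1r.
have delta_le : 16 * (d%:R * delta) <= 1.
  by rewrite mulrA mulrC -ler_pdivlMr ?mul1r // mulr_gt0 // ltr0n.
have delta0 : 0 <= delta by rewrite addr_ge0 // mulr_ge0 // ltW.
have small8 : (2 * d%:R * delta) ^+ d <= 8^-1.
  have h0 : 0 <= 2 * d%:R * delta by rewrite mulr_ge0 // mulr_ge0.
  apply: (@le_trans _ _ (2 * d%:R * delta)); last by lra.
  by rewrite -[X in _ <= X]expr1 ler_wiXn2l //; lra.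
have -> : 8 * d%:R * a_n + 8 * d%:R * b_n * x = 8 * d%:R * delta.
  by rewrite /delta; ring.
apply: ge_ereal_sup => _ [K bK <-].
have [n1|n1] := leqP n 1.
  have n1E : n = 1%N by apply/eqP; rewrite eqn_leq n1.
  have bound1 : 1 <= 12 ^+ d * expR (- (L * x ^+ d)).
    have xD : x ^+ d <= delta ^+ d.
      by move: D_ge; rewrite n1E ln1 add0r mul1r.
    have Lx : L * x ^+ d <= 8^-1.
      apply: (@le_trans _ _ ((2 * d%:R) ^+ d / 3 * delta ^+ d)).
        by apply: ler_pM => //; rewrite exprn_ge0.
      by move: small8; rewrite exprMn; have := exprn_ge0 d delta0; nra.
    have e1 := expR_ge1Dx (- (L * x ^+ d)).
    have e2 : 12 <= 12 ^+ d :> R by rewrite -{1}(expr1 12) ler_weXn2l //; lra.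
    have : 12 * (1 - 8^-1) <= 12 ^+ d * expR (- (L * x ^+ d)).
      by apply: ler_pM => //; lra.
    lra.
  apply: (@le_trans _ _ 1%E); last by rewrite lee_fin.
  by apply: probability_le1; case: bK => ? ? _; exact: measurable_dist_L_ge.
have ln1 : 1 <= ln n%:R :> R.
  apply: ln_ge1_of_small_ratio => //; rewrite -ad.
  have a_le : a_n <= delta by rewrite lerDl mulr_ge0 // ltW.
  have a16 : a_n <= 16^-1.
    apply: le_trans a_le _; have : delta <= d%:R * delta by rewrite ler_peMl.
    lra.
  apply: (le_trans _ a16); rewrite -[X in _ <= X]expr1 ler_wiXn2l //; lra.
have delta_gt0 : 0 < delta.
  rewrite lt_def delta0 andbT; apply/eqP => d0.
  move: D_ge; rewrite d0 expr0n (negbTE dn0) mulr0.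
  by have := exprn_ge0 d x0; lra.
have H := hull_deviation d_gt0 n_gt0 bK (iidX K bK) delta_gt0 small.

apply: (le_trans H).
rewrite lee_fin; apply: tail_bound => //; first by lra.
- by rewrite exprn_ge0.
- by have := exprn_ge0 d (_ : 0 <= 2 * d%:R :> R); lra.
Qed.
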